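(* Let $\varphi\in\mathcal{M}$. Suppose that both functions $P(z)=\varphi'(z)/\varphi(z)$ and $1-\varphi(z)$ have non-positive odd-order Taylor coefficients and non-negative even-order Taylor coefficients at $z=0$. Put $\phi(z)=\varphi(-z)$. Then for every $f\in\mathscr{S}^*(\varphi)$, $$\|P_f\|\le\sup_{0<s<1}\frac{1-s^2}{s}\left(-\frac{s\phi'(s)}{\phi(s)}-\phi(s)+1\right).$$
   Context: $\mathbb{D}=\{z\in\mathbb{C}:|z|<1\}$. $\mathscr{A}$ is the class of analytic functions $f$ on $\mathbb{D}$ with $f(0)=0$, $f'(0)=1$. For analytic $g,h$ on $\mathbb{D}$, $g\prec h$ (subordination) means $g=h\circ\omega$ for some analytic $\omega:\mathbb{D}\to\mathbb{D}$ with $\omega(0)=0$. $\mathcal{M}$ is the class of analytic univalent functions $\varphi$ in $\mathbb{D}$ with positive real part, $\varphi(0)=1$, $\varphi'(0)>0$, whose image $\varphi(\mathbb{D})$ is symmetric with respect to the real axis and starlike with respect to $1$. For $\varphi\in\mathcal{M}$, the Ma-Minda class is $\mathscr{S}^*(\varphi)=\{f\in\mathscr{A}: zf'(z)/f(z)\prec\varphi(z)\}$. For $f\in\mathscr{A}$ with $f'\neq0$ in $\mathbb{D}$, $P_f(z)=f''(z)/f'(z)$ and $\|P_f\|=\sup_{z\in\mathbb{D}}(1-|z|^2)|P_f(z)|$. *)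

(* Defs.v *)
From Stdlib Require Import Reals Arith.
From Coquelicot Require Import Coquelicot.
Open Scope C_scope.

Definition in_disk (z : C) : Prop := (Cmod z < 1)%R.

(* A power series converging to [f] around every point of the disk.  Functions
   are total on [C]; nothing is required of [f] outside the open unit disk. *)
Definition analytic_on_disk (f : C -> C) : Prop :=
  forall z0 : C, in_disk z0 ->
  exists (r : R) (a : nat -> C), (0 < r)%R /\
    forall z : C, (Cmod (z - z0) < r)%R ->
      @is_pseries C_AbsRing C_NormedModule a (z - z0) (f z).

(* [C_derive f z] is the complex derivative of [f] at [z] wherever [f] is
   complex differentiable; here it is only used at such points. *)
Definition C_derive_n (f : C -> C) (n : nat) : C -> C := Nat.iter n C_derive f.

Definition taylor_coeff (f : C -> C) (n : nat) : C :=
  C_derive_n f n 0 / INR (fact n).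

(* Sign conditions on a complex number assert in particular that it is real. *)
Definition C_pos (c : C) : Prop := Im c = 0%R /\ (0 < Re c)%R.
Definition C_nonneg (c : C) : Prop := Im c = 0%R /\ (0 <= Re c)%R.
Definition C_nonpos (c : C) : Prop := Im c = 0%R /\ (Re c <= 0)%R.

Definition odd_nonpos_even_nonneg (f : C -> C) : Prop :=
  forall n : nat,
    (Nat.Odd n -> C_nonpos (taylor_coeff f n)) /\
    (Nat.Even n -> C_nonneg (taylor_coeff f n)).

Definition univalent_on_disk (f : C -> C) : Prop :=
  forall z w : C, in_disk z -> in_disk w -> f z = f w -> z = w.

Definition disk_image (f : C -> C) (w : C) : Prop :=
  exists z : C, in_disk z /\ f z = w.

Definition symmetric_real_axis (E : C -> Prop) : Prop :=
  forall w : C, E w -> E (Cconj w).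

Definition starlike_wrt (c : C) (E : C -> Prop) : Prop :=
  E c /\
  forall (w : C) (t : R), E w -> (0 <= t <= 1)%R -> E ((1 - t) * c + t * w).

Definition class_A (f : C -> C) : Prop :=
  analytic_on_disk f /\ f 0 = 0 /\ C_derive f 0 = 1.

Definition subordinate (g h : C -> C) : Prop :=
  exists omega : C -> C,
    analytic_on_disk omega /\
    (forall z : C, in_disk z -> in_disk (omega z)) /\
    omega 0 = 0 /\
    (forall z : C, in_disk z -> g z = h (omega z)).

Definition class_M (phi : C -> C) : Prop :=
  analytic_on_disk phi /\
  univalent_on_disk phi /\
  (forall z : C, in_disk z -> (0 < Re (phi z))%R) /\
  phi 0 = 1 /\
  C_pos (C_derive phi 0) /\
  symmetric_real_axis (disk_image phi) /\
  starlike_wrt 1 (disk_image phi).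

(* z f'(z) / f(z), with the removable singularity at 0 filled in: for [f] in
   [class_A] the limit at 0 is 1, whereas the quotient itself is 0/0 there. *)
Definition zf'_over_f (f : C -> C) (z : C) : C :=
  if Ceq_dec z 0 then 1 else z * C_derive f z / f z.

(* The non-vanishing of [f] off the origin is what makes z f'(z) / f(z) an
   analytic function on the whole disk. *)
Definition ma_minda (phi f : C -> C) : Prop :=
  class_A f /\
  (forall z : C, in_disk z -> z <> 0 -> f z <> 0) /\
  subordinate (zf'_over_f f) phi.

Definition pre_schwarzian (f : C -> C) (z : C) : C :=
  C_derive (C_derive f) z / C_derive f z.

Definition pre_schwarzian_norm (f : C -> C) : Rbar :=
  Lub_Rbar (fun x : R => exists z : C, in_disk z /\
    x = ((1 - Cmod z ^ 2) * Cmod (pre_schwarzian f z))%R).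

(* Main.v *)
Require Import Defs.
From Stdlib Require Import Reals Arith Lra Lia Psatz Classical ClassicalEpsilon List.
From Coquelicot Require Import Coquelicot.
Open Scope C_scope.

(** Write [z f' / f = phi o w] with [w] a self-map of the disk fixing [0], and
    put [P = phi' / phi], [Q = 1 - phi]. Differentiating [z f' = f (phi o w)] gives
      [f'' / f' = - Q(w) / z + w' P(w)]   for [z <> 0]
    ([pre_schwarzian_formula]). The Schwarz-Pick inequality
    [|w'| (1 - |z|^2) <= 1 - |w|^2] then yields, with [r = |z|] and [s = |w(z)|],
      [(1 - r^2) |f'' / f'| <= (1 - r^2) / r |Q(w)| + (1 - s^2) |P(w)|].
    The sign conditions say that the moduli of the Taylor coefficients of [P] and
    [Q] are the coefficients of [P(-z)] and [Q(-z)], whence [|P(w)| <= P(-s)] and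
    [|Q(w)| <= Q(-s)] ([negative_axis_majorant]). Schwarz' lemma gives [s <= r],
    and [(1 - x^2) / x] decreases, so for [s > 0] the right-hand side is at most
    [(1 - s^2) / s (s P(-s) + Q(-s))], which is the expression under the supremum
    of the theorem, evaluated at [s]. If [s = 0] the right-hand side is [|P(0)|],
    the limit as [x] tends to [0] of the quantities [(1 - x^2) |P(x)|], each below
    the supremum; the point [z = 0] follows by continuity of [f'' / f'].

    Analyticity means a local power series at each point; the two classical
    ingredients are derived from these local expansions.
    - The majorant principle is obtained by propagating the inequalities between
      all derivatives along a ray ([derivative_majorant]), each local Taylor
      expansion carrying them a little further.
    - Schwarz-Pick follows from a maximum principle ([maximum_principle]):
      [|F|^2 + eps |z|^2] has a positive Laplacian, hence no interior maximum. It
      is applied to a quotient of two Blaschke factors ([pick_quotient]), whose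
      analyticity requires division of power series ([analytic_at_div]). *)

(** * Series of complex numbers *)

Notation C_series := (@is_series C_AbsRing C_NormedModule).

Lemma sum_n_Re (a : nat -> C) n :
  Re (@sum_n C_AbelianMonoid a n) = sum_n (fun k => Re (a k)) n.
Proof.
  induction n as [|n IH].
  - now rewrite !sum_O.
  - rewrite !sum_Sn, <- IH. reflexivity.
Qed.

Lemma sum_n_Im (a : nat -> C) n :
  Im (@sum_n C_AbelianMonoid a n) = sum_n (fun k => Im (a k)) n.
Proof.
  induction n as [|n IH].
  - now rewrite !sum_O.
  - rewrite !sum_Sn, <- IH. reflexivity.
Qed.

(** Reduces convergence in [C] to the theory of real series. *)
Lemma C_series_parts (a : nat -> C) (l : C) :
  C_series a l <->
  is_series (fun n => Re (a n)) (Re l) /\ is_series (fun n => Im (a n)) (Im l).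
Proof.
  split.
  - intros H; split.
    + apply (filterlim_ext (fun n => Re (@sum_n C_AbelianMonoid a n))).
      { intros n; apply sum_n_Re. }
      intros P [eps HP]. apply (H (fun c => P (Re c))). exists eps. intros y [Hy _]. now apply HP.
    + apply (filterlim_ext (fun n => Im (@sum_n C_AbelianMonoid a n))).
      { intros n; apply sum_n_Im. }
      intros P [eps HP]. apply (H (fun c => P (Im c))). exists eps. intros y [_ Hy]. now apply HP.
  - intros [H1 H2] P [eps HP].
    assert (K1 := H1 _ (locally_ball (Re l) eps)).
    assert (K2 := H2 _ (locally_ball (Im l) eps)).
    unfold filtermap in *.
    generalize (filter_and _ _ K1 K2). apply filter_imp. intros n [E1 E2].
    apply HP. rewrite <- sum_n_Re in E1. rewrite <- sum_n_Im in E2.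
    now split.
Qed.

Lemma C_series_unique (a : nat -> C) (l m : C) :
  C_series a l -> C_series a m -> l = m.
Proof.
  intros [H1 H2]%C_series_parts [K1 K2]%C_series_parts.
  apply injective_projections.
  - change (Re l = Re m). now rewrite <- (is_series_unique _ _ H1), (is_series_unique _ _ K1).
  - change (Im l = Im m). now rewrite <- (is_series_unique _ _ H2), (is_series_unique _ _ K2).
Qed.

Lemma C_series_ext (a b : nat -> C) l :
  (forall n, a n = b n) -> C_series a l -> C_series b l.
Proof. apply is_series_ext. Qed.

Lemma C_series_minus (a b : nat -> C) la lb :
  C_series a la -> C_series b lb -> C_series (fun n => a n - b n) (la - lb).
Proof. apply (is_series_minus (V := C_NormedModule)). Qed.

Lemma C_series_scal (c : C) (a : nat -> C) l :
  C_series a l -> C_series (fun n => c * a n) (c * l).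
Proof. apply (is_series_scal_l (V := C_NormedModule)). Qed.

Lemma C_series_shift (a : nat -> C) l :
  C_series a l -> C_series (fun n => a (S n)) (l - a O).
Proof.
  intros H. apply (is_series_incr_1 (V := C_NormedModule)).
  match goal with |- is_series _ ?x => replace x with l end; [exact H|].
  apply (fun x y : C => ltac:(ring) : x = x - y + y).
Qed.

Lemma C_series_unshift (a : nat -> C) l :
  C_series (fun n => a (S n)) l -> C_series a (a O + l).
Proof.
  intros H. apply (is_series_decr_1 (V := C_NormedModule)).
  match goal with |- is_series _ ?x => replace x with l end; [exact H|].
  apply (fun x y : C => ltac:(ring) : y = x + y + - x).
Qed.

Lemma im_le_Cmod (c : C) : (Rabs (Im c) <= Cmod c)%R.
Proof.
  apply Rle_trans with (2 := Rmax_Cmod c). apply Rmax_r.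
Qed.

Lemma C_series_of_norm (a : nat -> C) :
  ex_series (fun n => Cmod (a n)) -> exists l : C, C_series a l.
Proof.
  intros H.
  destruct (ex_series_le (V := C_CompleteNormedModule) a (fun n => Cmod (a n))) as [l Hl].
  - intros n. apply Rle_refl.
  - exact H.
  - now exists l.
Qed.

(** If [|c| <= 1], the real series of the [Re (c a_n)] is dominated by that of
    the [b_n]; the bound follows by choosing [c] with [c l = |l|]. *)
Lemma Cmod_series_le (a : nat -> C) (b : nat -> R) (l : C) (L : R) :
  C_series a l -> is_series b L -> (forall n, Cmod (a n) <= b n)%R ->
  (Cmod l <= L)%R.
Proof.
  intros Ha Hb Hab.
  assert (exists c : C, (Cmod c <= 1)%R /\ c * l = Cmod l) as (c & Hc & Hcl).
  { destruct (Ceq_dec l 0) as [->|Hl].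
    { exists 0. rewrite Cmod_0. split; [lra | ring]. }
    assert (Hm : (0 < Cmod l)%R) by now apply Cmod_gt_0.
    assert (Hm' : RtoC (Cmod l) <> 0) by (intros E; apply RtoC_inj in E; lra).
    exists (Cconj l / Cmod l). split.
    - rewrite Cmod_div, Cmod_conj, Cmod_R, Rabs_pos_eq by (lra || easy).
      apply Req_le. field. lra.
    - replace (Cconj l / Cmod l * l) with ((l * Cconj l) / Cmod l)
        by (unfold Cdiv; ring).
      rewrite <- Cmod2_conj, RtoC_pow. now field. }
  apply (C_series_scal c) in Ha. apply C_series_parts in Ha. destruct Ha as [Ha _].
  rewrite Hcl, re_RtoC in Ha.
  assert (Hlim : Rbar_le (Cmod l) L).
  { eapply (filterlim_le (F := eventually)); [| exact Ha | exact Hb].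
    exists O. intros n _. apply sum_n_m_le. intros k.
    apply Rle_trans with (2 := Hab k).
    apply Rle_trans with (1 := Rle_abs _).
    apply Rle_trans with (1 := re_le_Cmod _). rewrite Cmod_mult.
    rewrite <- (Rmult_1_l (Cmod (a k))) at 2.
    apply Rmult_le_compat_r; [apply Cmod_ge_0 | exact Hc]. }
  exact Hlim.
Qed.

Lemma C_series_bounded (a : nat -> C) l :
  C_series a l -> exists M, forall n, (Cmod (a n) <= M)%R.
Proof.
  intros [H1 H2]%C_series_parts.
  assert (B : forall u : nat -> R, ex_series u -> exists M, forall n, (Rabs (u n) <= M)%R).
  { intros u Hu. apply ex_series_lim_0, is_lim_seq_Reals in Hu.
    destruct (maj_by_pos u (exist _ _ Hu)) as [M [_ HM]].
    now exists M. }
  destruct (B _ (ex_intro _ _ H1)) as [M1 K1].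
  destruct (B _ (ex_intro _ _ H2)) as [M2 K2].
  exists (sqrt 2 * Rmax M1 M2)%R. intros n.
  apply Rle_trans with (1 := Cmod_2Rmax (a n)).
  apply Rmult_le_compat_l; [apply sqrt_pos|].
  apply Rmax_lub.
  - apply Rle_trans with (2 := Rmax_l _ _). apply K1.
  - apply Rle_trans with (2 := Rmax_r _ _). apply K2.
Qed.

(** From the four real Cauchy products of the real and imaginary parts. *)
Lemma C_series_mult (a b : nat -> C) (la lb : C) :
  C_series a la -> C_series b lb ->
  ex_series (fun n => Cmod (a n)) -> ex_series (fun n => Cmod (b n)) ->
  C_series (fun n => @sum_n C_AbelianMonoid (fun k => a k * b (n - k)%nat) n)
    (la * lb).
Proof.
  intros Ha Hb Aa Ab.
  assert (DR : forall u : nat -> C, ex_series (fun n => Cmod (u n)) ->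
             ex_series (fun n => Rabs (Re (u n)))).
  { intros u Hu. apply (ex_series_le (V := R_CompleteNormedModule)) with (2 := Hu).
    intros n. change (Rabs (Rabs (Re (u n))) <= Cmod (u n))%R.
    rewrite Rabs_Rabsolu. apply re_le_Cmod. }
  assert (DI : forall u : nat -> C, ex_series (fun n => Cmod (u n)) ->
             ex_series (fun n => Rabs (Im (u n)))).
  { intros u Hu. apply (ex_series_le (V := R_CompleteNormedModule)) with (2 := Hu).
    intros n. change (Rabs (Rabs (Im (u n))) <= Cmod (u n))%R.
    rewrite Rabs_Rabsolu. apply im_le_Cmod. }
  apply C_series_parts in Ha, Hb. destruct Ha as [a1 a2], Hb as [b1 b2].
  apply C_series_parts; split.
  - rewrite re_mult.
    eapply is_series_ext; [|apply (is_series_minus _ _ _ _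
      (is_series_mult _ _ _ _ a1 b1 (DR _ Aa) (DR _ Ab))
      (is_series_mult _ _ _ _ a2 b2 (DI _ Aa) (DI _ Ab)))].
    intros n. rewrite sum_n_Re, <- !sum_n_Reals.
    enough (E : forall m, (sum_n (fun k => Re (a k) * Re (b (n - k)%nat))%R m -
              sum_n (fun k => Im (a k) * Im (b (n - k)%nat))%R m =
              sum_n (fun k => Re (a k * b (n - k)%nat)) m)%R) by exact (E n).
    induction m as [|m IH].
    + rewrite !sum_O. now rewrite re_mult.
    + rewrite !sum_Sn, <- IH, re_mult. unfold plus; simpl. ring.
  - rewrite im_mult.
    eapply is_series_ext; [|apply (is_series_plus _ _ _ _
      (is_series_mult _ _ _ _ a1 b2 (DR _ Aa) (DI _ Ab))
      (is_series_mult _ _ _ _ a2 b1 (DI _ Aa) (DR _ Ab)))].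
    intros n. rewrite sum_n_Im, <- !sum_n_Reals.
    enough (E : forall m, (sum_n (fun k => Re (a k) * Im (b (n - k)%nat))%R m +
              sum_n (fun k => Im (a k) * Re (b (n - k)%nat))%R m =
              sum_n (fun k => Im (a k * b (n - k)%nat)) m)%R) by exact (E n).
    induction m as [|m IH].
    + rewrite !sum_O. now rewrite im_mult.
    + rewrite !sum_Sn, <- IH, im_mult. unfold plus; simpl. ring.
Qed.

(** * Power series and their derivatives *)

(** The series is indexed by its centre, its radius and its coefficients, so that
    statements about all derivatives of [f] can share one disk. *)
Definition power_series_at (f : C -> C) (z0 : C) (r : R) (a : nat -> C) : Prop :=
  (0 < r)%R /\
  forall z, (Cmod (z - z0) < r)%R -> C_series (fun n => a n * (z - z0) ^ n) (f z).

Definition analytic_at (f : C -> C) (z0 : C) : Prop :=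
  exists r a, power_series_at f z0 r a.

Lemma pow_n_Cpow (z : C) n : @pow_n C_Ring z n = z ^ n.
Proof.
  induction n as [|n IH]; [reflexivity|].
  change (@pow_n C_Ring z (S n)) with (z * @pow_n C_Ring z n).
  now rewrite IH, Cpow_S.
Qed.

Lemma analytic_on_disk_at f z : analytic_on_disk f -> in_disk z -> analytic_at f z.
Proof.
  intros Hf Hz. destruct (Hf z Hz) as (r & a & Hr & Ha).
  exists r, a. split; [exact Hr|]. intros w Hw.
  apply C_series_ext with (2 := Ha w Hw). intros n.
  change (@pow_n C_Ring (w - z) n * a n = a n * (w - z) ^ n).
  rewrite pow_n_Cpow. ring.
Qed.

Lemma power_series_at_shrink f z0 r r' a :
  power_series_at f z0 r a -> (0 < r' <= r)%R -> power_series_at f z0 r' a.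
Proof.
  intros [Hr H] Hr'. split; [lra|]. intros z Hz. apply H. lra.
Qed.

(** The terms are bounded at every radius [rho < r], where the series converges,
    so the real majorant series of the [|a n|] inherits the radius. *)
Lemma radius_le_CV_radius f z0 r a x :
  power_series_at f z0 r a -> (0 <= x < r)%R ->
  Rbar_lt (Rabs x) (CV_radius (fun n => Cmod (a n))).
Proof.
  intros [Hr H] Hx. set (rho := ((x + r) / 2)%R).
  assert (Hrho : (x < rho < r)%R) by (unfold rho; lra).
  assert (E : z0 + rho - z0 = rho) by ring.
  destruct (C_series_bounded _ _ (H (z0 + rho) ltac:(rewrite E, Cmod_R, Rabs_pos_eq; lra)))
    as [M HM].
  apply Rbar_lt_le_trans with rho.
  - simpl. rewrite Rabs_pos_eq; lra.
  - apply (CV_radius_bounded (fun n => Cmod (a n))). exists M. intros n.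
    specialize (HM n). rewrite E, Cmod_mult, Cmod_pow, Cmod_R, (Rabs_pos_eq rho) in HM by lra.
    rewrite Rabs_pos_eq; [exact HM|].
    apply Rmult_le_pos; [apply Cmod_ge_0 | apply pow_le; lra].
Qed.

Lemma power_series_abs_conv f z0 r a z :
  power_series_at f z0 r a -> (Cmod (z - z0) < r)%R ->
  ex_series (fun n => Cmod (a n * (z - z0) ^ n)).
Proof.
  intros H Hz.
  apply (ex_series_ext (fun n => Rabs (Cmod (a n) * Cmod (z - z0) ^ n))).
  - intros n. rewrite Cmod_mult, Cmod_pow. apply Rabs_pos_eq.
    apply Rmult_le_pos; [|apply pow_le]; apply Cmod_ge_0.
  - apply CV_disk_inside. apply (radius_le_CV_radius _ _ _ _ _ H).
    split; [apply Cmod_ge_0 | exact Hz].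
Qed.

(** By induction: with [T_n] the remainder of order [n],
    [T_(n+1) = (x + h) T_n + n x^(n-1) h^2]. *)
Lemma pow_second_order_remainder (x h : C) (rho : R) n :
  (Cmod x <= rho)%R -> (Cmod (x + h) <= rho)%R ->
  (Cmod ((x + h) ^ S (S n) - x ^ S (S n) - INR (S (S n)) * x ^ S n * h)
   <= INR (S (S n)) * INR (S n) * rho ^ n * Cmod h ^ 2)%R.
Proof.
  intros Hx Hxh. assert (Hrho : (0 <= rho)%R) by (generalize (Cmod_ge_0 x); lra).
  generalize (Cmod_ge_0 h); intros Hh.
  induction n as [|n IH].
  - replace ((x + h) ^ 2 - x ^ 2 - INR 2 * x ^ 1 * h) with (h ^ 2).
    + rewrite Cmod_pow. simpl. nra.
    + replace (RtoC (INR 2)) with (1 + 1) by (rewrite <- RtoC_plus; f_equal; simpl; ring).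
      simpl. ring.
  - replace ((x + h) ^ S (S (S n)) - x ^ S (S (S n)) - INR (S (S (S n))) * x ^ S (S n) * h)
      with ((x + h) * ((x + h) ^ S (S n) - x ^ S (S n) - INR (S (S n)) * x ^ S n * h)
            + INR (S (S n)) * x ^ S n * h ^ 2).
    2: { rewrite (S_INR (S (S n))), RtoC_plus. rewrite !Cpow_S. change (x ^ 0) with (RtoC 1). ring. }
    apply Rle_trans with (1 := Cmod_triangle _ _). rewrite !Cmod_mult.
    assert (P1 : (Cmod (x ^ S n) <= rho ^ S n)%R).
    { rewrite Cmod_pow. apply pow_incr. split; [apply Cmod_ge_0 | exact Hx]. }
    rewrite !Cmod_pow in *. rewrite Cmod_R, (Rabs_pos_eq (INR _)) by apply pos_INR.
    set (T := Cmod (_ - _)) in *.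
    set (N2 := INR (S (S n))) in *.
    assert (EN : INR (S n) = (N2 - 1)%R) by (unfold N2; rewrite (S_INR (S n)); ring).
    rewrite EN in IH.
    rewrite (S_INR (S (S n))). fold N2.
    assert (HN2 : (1 <= N2)%R) by (unfold N2; rewrite S_INR; generalize (pos_INR (S n)); lra).
    assert (Hp : (0 <= rho ^ n)%R) by now apply pow_le.
    apply Rle_trans with (rho * (N2 * (N2 - 1) * rho ^ n * Cmod h ^ 2) +
                          N2 * rho ^ S n * Cmod h ^ 2)%R.
    + apply Rplus_le_compat.
      * apply Rmult_le_compat; try apply Cmod_ge_0; assumption.
      * apply Rmult_le_compat_r; [apply pow2_ge_0|].
        apply Rmult_le_compat_l; lra.
    + simpl pow. assert (0 <= N2 * (rho * rho ^ n) * (Cmod h * (Cmod h * 1)))%R.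
      { repeat apply Rmult_le_pos; lra. }
      nra.
Qed.

Definition deriv_coeff (a : nat -> C) (n : nat) : C := INR (S n) * a (S n).

Lemma Cmod_deriv_coeff a n :
  Cmod (deriv_coeff a n) = PS_derive (fun n => Cmod (a n)) n.
Proof.
  unfold deriv_coeff, PS_derive. rewrite Cmod_mult, Cmod_R, Rabs_pos_eq; [easy | apply pos_INR].
Qed.

(** Comparison with the twice differentiated majorant series of the [|a n|],
    which has the same radius of convergence. *)
Lemma power_series_taylor1 f z0 r a z :
  power_series_at f z0 r a -> (Cmod (z - z0) < r)%R ->
  exists D : C, C_series (fun n => deriv_coeff a n * (z - z0) ^ n) D /\
  exists K eta : R, (0 < eta)%R /\ forall h, (Cmod h < eta)%R ->
    (Cmod (f (z + h)%C - f z - D * h) <= K * Cmod h ^ 2)%R.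
Proof.
  intros H Hz. set (x := z - z0) in *.
  destruct (C_series_of_norm (fun n => deriv_coeff a n * x ^ n)) as [D HD].
  { apply (ex_series_ext (fun n => Rabs (PS_derive (fun n => Cmod (a n)) n * Cmod x ^ n))).
    - intros n. rewrite Cmod_mult, Cmod_pow, Cmod_deriv_coeff, <- Cmod_deriv_coeff.
      apply Rabs_pos_eq. apply Rmult_le_pos; [|apply pow_le]; apply Cmod_ge_0.
    - apply CV_disk_inside. rewrite CV_radius_derive.
      apply (radius_le_CV_radius _ _ _ _ _ H). split; [apply Cmod_ge_0 | exact Hz]. }
  exists D. split; [exact HD|].
  (* [x] and [x + h] both stay within [rho < r] as long as [|h| < eta]. *)
  set (eta := ((r - Cmod x) / 2)%R). set (rho := (Cmod x + eta)%R).
  assert (Heta : (0 < eta)%R) by (unfold eta; lra).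
  assert (Hx := Cmod_ge_0 x).
  assert (Hrho : (0 <= rho < r)%R) by (unfold rho, eta; lra).
  set (b := PS_derive (PS_derive (fun n => Cmod (a n)))).
  assert (Hb : ex_series (fun n => b n * rho ^ n)%R).
  { apply ex_series_Rabs. apply CV_disk_inside. unfold b. rewrite !CV_radius_derive.
    now apply (radius_le_CV_radius _ _ _ _ _ H). }
  destruct Hb as [K HK].
  exists K, eta. split; [exact Heta|]. intros h Hh.
  assert (Hxh : (Cmod (x + h) <= rho)%R).
  { apply Rle_trans with (1 := Cmod_triangle _ _). unfold rho. lra. }
  assert (S1 : C_series (fun n => a n * (x + h) ^ n) (f (z + h))).
  { replace (x + h) with (z + h - z0) by (unfold x; ring). apply H.
    replace (z + h - z0) with (x + h) by (unfold x; ring). lra. }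
  assert (S2 : C_series (fun n => a n * x ^ n) (f z)) by now apply H.
  assert (S3 := C_series_unshift (fun n => match n with O => RtoC 0 | S m => h * (deriv_coeff a m * x ^ m) end)
     _ (C_series_scal h _ _ HD)).
  assert (S4 := C_series_shift _ _ (C_series_shift _ _ (C_series_minus _ _ _ _ (C_series_minus _ _ _ _ S1 S2) S3))).
  cbv beta iota in S4.
  apply (Cmod_series_le _ (fun n => Cmod h ^ 2 * (b n * rho ^ n))%R _ (Cmod h ^ 2 * K)%R) in S4.
  - rewrite Rmult_comm. replace (f (z + h) - f z - D * h) with
     (f (z + h) - f z - (0 + h * D) -
       (a 0%nat * (x + h) ^ 0 - a 0%nat * x ^ 0 - 0) -
       (a 1%nat * (x + h) ^ 1 - a 1%nat * x ^ 1 - h * (deriv_coeff a 0 * x ^ 0))).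
    exact S4.
    unfold deriv_coeff. simpl. ring.
  - apply (is_series_scal_l (V := R_NormedModule)). exact HK.
  - intros n.
    replace (a (S (S n)) * (x + h) ^ S (S n) - a (S (S n)) * x ^ S (S n) -
       h * (deriv_coeff a (S n) * x ^ S n)) with
      (a (S (S n)) * ((x + h) ^ S (S n) - x ^ S (S n) - INR (S (S n)) * x ^ S n * h))
      by (unfold deriv_coeff; ring).
    rewrite Cmod_mult.
    assert (Hx' : (Cmod x <= rho)%R) by (unfold rho; lra).
    apply Rle_trans with (1 := Rmult_le_compat_l _ _ _ (Cmod_ge_0 _)
      (pow_second_order_remainder x h rho n Hx' Hxh)).
    apply Req_le. unfold b, PS_derive. ring.
Qed.

Lemma is_derive_of_quadratic (f : C -> C) (z l : C) (K eta : R) :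
  (0 < eta)%R ->
  (forall h, (Cmod h < eta)%R -> (Cmod (f (z + h)%C - f z - l * h) <= K * Cmod h ^ 2)%R) ->
  @is_derive C_AbsRing C_NormedModule f z l.
Proof.
  intros Heta H. split; [apply is_linear_scal_l|].
  intros x Hx. apply (is_filter_lim_locally_unique (V := AbsRing_NormedModule C_AbsRing)) in Hx. subst x.
  intros eps.
  assert (Hd : (0 < Rmin eta (eps / (Rabs K + 1)))%R).
  { apply Rmin_pos; [exact Heta|]. apply Rdiv_lt_0_compat; [apply cond_pos|].
    generalize (Rabs_pos K); lra. }
  exists (mkposreal _ Hd). intros y0 Hy. revert Hy. generalize (y0 : C). clear y0. intros y Hy.
  change (Cmod (y - z) < Rmin eta (eps / (Rabs K + 1)))%R in Hy.
  change (Cmod (f y - f z - (y - z) * l) <= eps * Cmod (y - z))%R.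
  assert (H1 := H (y - z)). replace (z + (y - z)) with y in H1 by ring.
  replace ((y - z) * l) with (l * (y - z)) by ring.
  apply Rle_trans with (1 := H1 (Rlt_le_trans _ _ _ Hy (Rmin_l _ _))).
  assert (Hy2 := Rlt_le_trans _ _ _ Hy (Rmin_r _ _)).
  simpl pow. rewrite Rmult_1_r, <- Rmult_assoc.
  apply Rmult_le_compat_r; [apply Cmod_ge_0|].
  apply Rle_trans with ((Rabs K + 1) * Cmod (y - z))%R.
  - apply Rmult_le_compat_r; [apply Cmod_ge_0|]. generalize (Rle_abs K); lra.
  - apply Rlt_le. replace (pos eps) with ((Rabs K + 1) * (eps / (Rabs K + 1)))%R.
    apply Rmult_lt_compat_l; [generalize (Rabs_pos K); lra | exact Hy2].
    field. generalize (Rabs_pos K); lra.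
Qed.

Lemma power_series_is_derive f z0 r a z :
  power_series_at f z0 r a -> (Cmod (z - z0) < r)%R ->
  @is_derive C_AbsRing C_NormedModule f z (C_derive f z).
Proof.
  intros H Hz. destruct (power_series_taylor1 f z0 r a z H Hz) as (D & _ & K & eta & He & HK).
  assert (HD := is_derive_of_quadratic f z D K eta He HK).
  now rewrite (is_C_derive_unique _ _ _ HD).
Qed.

(** Termwise differentiation keeps the disk on which the series represents the
    function, hence every derivative of [f] has a power series on that disk. *)
Lemma power_series_derive f z0 r a :
  power_series_at f z0 r a -> power_series_at (C_derive f) z0 r (deriv_coeff a).
Proof.
  intros H. split; [apply H|]. intros z Hz.
  destruct (power_series_taylor1 f z0 r a z H Hz) as (D & HD & K & eta & He & HK).
  rewrite (is_C_derive_unique _ _ _ (is_derive_of_quadratic f z D K eta He HK)).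
  exact HD.
Qed.

Lemma power_series_center f z0 r a : power_series_at f z0 r a -> f z0 = a O.
Proof.
  intros [Hr H]. assert (E : z0 - z0 = 0) by ring.
  specialize (H z0). rewrite E, Cmod_0 in H. specialize (H Hr).
  assert (Z : C_series (fun n => match n with O => a O | S _ => RtoC 0 end) (a O + 0)).
  { apply (C_series_unshift (fun n => match n with O => a O | S _ => RtoC 0 end)).
    assert (Z := C_series_scal 0 _ _ H). rewrite Cmult_0_l in Z.
    apply C_series_ext with (2 := Z). intros n. ring. }
  rewrite Cplus_0_r in Z. apply (C_series_unique _ _ _ H).
  apply C_series_ext with (2 := Z). intros [|n]; rewrite ?Cpow_S; simpl; ring.
Qed.

Lemma power_series_derive_n f z0 r a n :
  power_series_at f z0 r a ->
  power_series_at (C_derive_n f n) z0 r (Nat.iter n deriv_coeff a).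
Proof.
  intros H. induction n as [|n IH]; [exact H|].
  apply (power_series_derive _ _ _ _ IH).
Qed.

Lemma iter_deriv_coeff_0 a n : Nat.iter n deriv_coeff a O = INR (fact n) * a n.
Proof.
  assert (G : forall k, Nat.iter n deriv_coeff a k * INR (fact k) = INR (fact (k + n)) * a (k + n)%nat).
  { induction n as [|n IH]; intros k.
    - simpl. rewrite Nat.add_0_r. ring.
    - change (Nat.iter (S n) deriv_coeff a k) with (deriv_coeff (Nat.iter n deriv_coeff a) k).
      unfold deriv_coeff at 1.
      replace (INR (S k) * Nat.iter n deriv_coeff a (S k) * INR (fact k))
        with (Nat.iter n deriv_coeff a (S k) * INR (fact (S k))).
      + rewrite IH. now rewrite Nat.add_succ_r.
      + rewrite fact_simpl, mult_INR, RtoC_mult. ring. }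
  specialize (G O). simpl fact in G at 1. simpl INR in G at 1. rewrite Cmult_1_r in G. exact G.
Qed.

Lemma power_series_coeff f z0 r a n :
  power_series_at f z0 r a -> a n = C_derive_n f n z0 / INR (fact n).
Proof.
  intros H. rewrite (power_series_center _ _ _ _ (power_series_derive_n _ _ _ _ n H)).
  rewrite iter_deriv_coeff_0. field.
  intros E. apply RtoC_inj in E. now apply (INR_fact_neq_0 n).
Qed.

Lemma C_derive_n_plus f n k z : C_derive_n (C_derive_n f n) k z = C_derive_n f (k + n) z.
Proof. unfold C_derive_n. now rewrite Nat.iter_add. Qed.

(** The disk does not depend on [n]; the propagation of a family of inequalities
    between all derivatives relies on this uniformity. *)
Lemma taylor_series f z0 r a n z :
  power_series_at f z0 r a -> (Cmod (z - z0) < r)%R ->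
  C_series (fun k => C_derive_n f (k + n) z0 / INR (fact k) * (z - z0) ^ k)
    (C_derive_n f n z).
Proof.
  intros H Hz. assert (Hn := power_series_derive_n _ _ _ _ n H).
  apply C_series_ext with (2 := proj2 Hn z Hz). intros k.
  now rewrite (power_series_coeff _ _ _ _ k Hn), C_derive_n_plus.
Qed.

(** * Algebra of analytic functions *)

Notation C_sum_n := (@sum_n C_AbelianMonoid).

Lemma analytic_at_ext f g z0 d :
  (0 < d)%R -> (forall z, (Cmod (z - z0) < d)%R -> f z = g z) ->
  analytic_at f z0 -> analytic_at g z0.
Proof.
  intros Hd E (r & a & Hf). assert (Hr := proj1 Hf). exists (Rmin r d), a.
  split; [now apply Rmin_pos|]. intros z Hz.
  rewrite <- E by apply (Rlt_le_trans _ _ _ Hz (Rmin_r _ _)).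
  apply Hf, (Rlt_le_trans _ _ _ Hz (Rmin_l _ _)).
Qed.

Lemma analytic_at_derive f z0 : analytic_at f z0 -> analytic_at (C_derive f) z0.
Proof. intros (r & a & H). exists r, (deriv_coeff a). now apply power_series_derive. Qed.

Lemma analytic_at_is_derive f z0 :
  analytic_at f z0 -> @is_derive C_AbsRing C_NormedModule f z0 (C_derive f z0).
Proof.
  intros (r & a & H). apply (power_series_is_derive _ _ _ _ _ H).
  replace (z0 - z0) with (RtoC 0) by ring. rewrite Cmod_0. apply H.
Qed.

Lemma analytic_at_continuous f z0 eps :
  analytic_at f z0 -> (0 < eps)%R ->
  exists d : R, (0 < d)%R /\
    forall z, (Cmod (z - z0) < d)%R -> (Cmod (f z - f z0) < eps)%R.
Proof.
  intros (r & a & H) He.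
  destruct (power_series_taylor1 f z0 r a z0 H) as (D & _ & K & eta & Heta & HK).
  { replace (z0 - z0) with (RtoC 0) by ring. rewrite Cmod_0. apply H. }
  set (B := (Cmod D + Rabs K + 1)%R).
  assert (HD := Cmod_ge_0 D). assert (HK0 := Rabs_pos K). assert (HK1 := Rle_abs K).
  exists (Rmin (Rmin eta 1) (eps / B)). split.
  { repeat apply Rmin_pos; try lra. apply Rdiv_lt_0_compat; unfold B; lra. }
  intros z Hz. assert (Hz1 := Rlt_le_trans _ _ _ Hz (Rmin_l _ _)).
  assert (Hz2 := Rlt_le_trans _ _ _ Hz (Rmin_r _ _)).
  assert (Hz3 := Rlt_le_trans _ _ _ Hz1 (Rmin_l _ _)).
  assert (Hz4 := Rlt_le_trans _ _ _ Hz1 (Rmin_r _ _)).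
  specialize (HK _ Hz3). set (h := z - z0) in *.
  replace (z0 + h) with z in HK by (unfold h; ring).
  replace (f z - f z0) with ((f z - f z0 - D * h) + D * h) by ring.
  apply Rle_lt_trans with (1 := Cmod_triangle _ _). rewrite Cmod_mult.
  assert (Hh := Cmod_ge_0 h).
  apply Rle_lt_trans with (B * Cmod h)%R.
  - assert (H2 : (K * Cmod h ^ 2 <= Rabs K * Cmod h)%R).
    { simpl. rewrite Rmult_1_r. apply Rle_trans with (Rabs K * (Cmod h * Cmod h))%R.
      - apply Rmult_le_compat_r; [now apply Rmult_le_pos | exact HK1].
      - apply Rmult_le_compat_l; [exact HK0|]. rewrite <- (Rmult_1_r (Cmod h)) at 3.
        apply Rmult_le_compat_l; lra. }
    unfold B. rewrite !Rmult_plus_distr_r. lra.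
  - replace eps with (B * (eps / B))%R by (field; unfold B; lra).
    apply Rmult_lt_compat_l; [unfold B; lra | exact Hz2].
Qed.

Lemma analytic_at_neq_0 f z0 :
  analytic_at f z0 -> f z0 <> 0 ->
  exists d : R, (0 < d)%R /\ forall z, (Cmod (z - z0) < d)%R -> f z <> 0.
Proof.
  intros H H0. destruct (analytic_at_continuous f z0 (Cmod (f z0)) H) as (d & Hd & K).
  { now apply Cmod_gt_0. }
  exists d. split; [exact Hd|]. intros z Hz E. specialize (K z Hz).
  rewrite E in K. replace (0 - f z0) with (- f z0) in K by ring.
  rewrite Cmod_opp in K. lra.
Qed.

Lemma C_series_0 : C_series (fun _ => RtoC 0) (RtoC 0).
Proof.
  apply (filterlim_ext (fun _ => RtoC 0)); [|apply filterlim_const].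
  intros n. induction n as [|n IH]; [now rewrite sum_O|].
  rewrite sum_Sn, <- IH. change (RtoC 0 = 0 + 0). ring.
Qed.

Lemma analytic_at_affine (a b z0 : C) : analytic_at (fun z => a + b * z) z0.
Proof.
  exists 1%R, (fun n => match n with O => a + b * z0 | S O => b | _ => RtoC 0 end).
  split; [lra|]. intros z _.
  assert (E : C_series (fun n => match n with O => a + b * z0 | S O => b * (z - z0) | _ => RtoC 0 end)
     ((a + b * z0) + (b * (z - z0) + 0))).
  { apply (C_series_unshift (fun n => match n with O => a + b * z0 | S O => b * (z - z0) | _ => RtoC 0 end)).
    apply (C_series_unshift (fun n => match n with O => b * (z - z0) | _ => RtoC 0 end)).
    exact C_series_0. }
  replace (a + b * z) with ((a + b * z0) + (b * (z - z0) + 0)) by ring.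
  apply C_series_ext with (2 := E). intros [|[|n]]; simpl; ring.
Qed.

Lemma power_series_common f g z0 :
  analytic_at f z0 -> analytic_at g z0 ->
  exists r a b, power_series_at f z0 r a /\ power_series_at g z0 r b.
Proof.
  intros (r & a & H) (s & b & K). exists (Rmin r s), a, b.
  assert (Hr := proj1 H). assert (Hs := proj1 K). assert (M := Rmin_pos _ _ Hr Hs).
  split; [apply (power_series_at_shrink _ _ _ _ _ H) | apply (power_series_at_shrink _ _ _ _ _ K)];
    (split; [exact M | apply Rmin_l || apply Rmin_r]).
Qed.

Lemma analytic_at_minus f g z0 :
  analytic_at f z0 -> analytic_at g z0 -> analytic_at (fun z => f z - g z) z0.
Proof.
  intros H K. destruct (power_series_common _ _ _ H K) as (r & a & b & Ha & Hb).
  exists r, (fun n => a n - b n). split; [apply Ha|]. intros z Hz.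
  apply C_series_ext with (2 := C_series_minus _ _ _ _ (proj2 Ha z Hz) (proj2 Hb z Hz)).
  intros n. ring.
Qed.

Lemma C_sum_n_convolution (a b : nat -> C) (x : C) n :
  C_sum_n (fun k => a k * x ^ k * (b (n - k)%nat * x ^ (n - k))) n =
  C_sum_n (fun k => a k * b (n - k)%nat) n * x ^ n.
Proof.
  rewrite (sum_n_ext_loc (G := C_AbelianMonoid) _ (fun k => a k * b (n - k)%nat * x ^ n)).
  - set (u := fun k => a k * b (n - k)%nat). generalize (x ^ n). intros y.
    change (C_sum_n (fun k => u k * y) n = C_sum_n u n * y). generalize u. clear u. intros u.
    induction n as [|m IH]; [now rewrite !sum_O|].
    rewrite !sum_Sn, IH. change (C_sum_n u m * y + u (S m) * y = (C_sum_n u m + u (S m)) * y). ring.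
  - intros k Hk. assert (E : x ^ n = x ^ k * x ^ (n - k)).
    { rewrite <- Cpow_add_r. f_equal. lia. }
    rewrite E. change (@eq C (a k * x ^ k * (b (n - k)%nat * x ^ (n - k)))
      (a k * b (n - k)%nat * (x ^ k * x ^ (n - k)))). ring.
Qed.

Lemma analytic_at_mult f g z0 :
  analytic_at f z0 -> analytic_at g z0 -> analytic_at (fun z => f z * g z) z0.
Proof.
  intros H K. destruct (power_series_common _ _ _ H K) as (r & a & b & Ha & Hb).
  exists r, (fun n => C_sum_n (fun k => a k * b (n - k)%nat) n). split; [apply Ha|].
  intros z Hz.
  eapply C_series_ext; [|apply (C_series_mult _ _ _ _ (proj2 Ha z Hz) (proj2 Hb z Hz));
     eapply power_series_abs_conv; eassumption].
  intros n. apply C_sum_n_convolution.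
Qed.

Lemma Cmod_sum_n_le (u : nat -> C) n :
  (Cmod (C_sum_n u n) <= sum_n (fun k => Cmod (u k)) n)%R.
Proof.
  induction n as [|n IH]; [rewrite !sum_O; apply Rle_refl|].
  rewrite !sum_Sn. apply Rle_trans with (1 := Cmod_triangle _ _).
  apply Rplus_le_compat_r, IH.
Qed.

Lemma quotient_coeff_exists (a c : nat -> C) :
  c O <> 0 ->
  exists p, p O = a O / c O /\
    forall n, p (S n) = (a (S n) - C_sum_n (fun k => p k * c (S n - k)%nat) n) / c O.
Proof.
  intros Hc.
  (* [T n] holds the first [n + 1] coefficients. *)
  pose (T := fix T (n : nat) : nat -> C := match n with
    | O => fun _ => a O / c O
    | S m => fun k => if (k <=? m)%nat then T m k else
        (a (S m) - C_sum_n (fun k => T m k * c (S m - k)%nat) m) / c O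
    end).
  assert (HT : forall n k, (k <= n)%nat -> T n k = T k k).
  { intros n. induction n as [|n IH]; intros k Hk.
    - now replace k with O by lia.
    - destruct (Nat.eq_dec k (S n)) as [->|Hne]; [reflexivity|].
      rewrite <- (IH k) by lia. simpl.
      destruct (Nat.leb_spec k n); [reflexivity | lia]. }
  exists (fun n => T n n). split; [reflexivity|]. intros n.
  change (T (S n) (S n)) with (if (S n <=? n)%nat then T n (S n) else
     (a (S n) - C_sum_n (fun k => T n k * c (S n - k)%nat) n) / c O).
  replace (S n <=? n)%nat with false by (symmetry; apply Nat.leb_gt; lia).
  f_equal. f_equal. apply (sum_n_ext_loc (G := C_AbelianMonoid)). intros k Hk. now rewrite HT.
Qed.

(** If [|p k| <= A (2 M)^k] for [k <= n], the recursion bounds [|p (n+1)|] by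
    [A M^(n+1) (1 + (1 + 2 + ... + 2^n)) = A (2 M)^(n+1)]. *)
Lemma quotient_coeff_bound (a c p : nat -> C) (A M : R) :
  c O <> 0 -> (0 <= A)%R -> (0 <= M)%R ->
  (forall n, Cmod (a n) <= Cmod (c O) * (A * M ^ n))%R ->
  (forall n, (0 < n)%nat -> Cmod (c n) <= Cmod (c O) * M ^ n)%R ->
  p O = a O / c O ->
  (forall n, p (S n) = (a (S n) - C_sum_n (fun k => p k * c (S n - k)%nat) n) / c O) ->
  forall n, (Cmod (p n) <= A * (2 * M) ^ n)%R.
Proof.
  intros Hc HA HM Ha Hcn H0 HS.
  assert (Hc0 : (0 < Cmod (c O))%R) by now apply Cmod_gt_0.
  intros n. induction n as [n IH] using (well_founded_induction lt_wf).
  destruct n as [|n].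
  - rewrite H0, Cmod_div by exact Hc. apply Rle_div_l; [lra|].
    specialize (Ha O). simpl in *. lra.
  - rewrite HS, Cmod_div by exact Hc. apply Rle_div_l; [lra|].
    apply Rle_trans with (1 := Cmod_triangle _ _). rewrite Cmod_opp.
    assert (E : (sum_n (fun k => 2 ^ k) n + 1 = 2 ^ S n)%R).
    { clear. induction n as [|n IH]; [rewrite sum_O; simpl; ring|].
      rewrite sum_Sn. change (sum_n (fun k => 2 ^ k) n + 2 ^ S n + 1 = 2 ^ S (S n))%R.
      simpl pow in *. lra. }
    assert (B : (Cmod (C_sum_n (fun k => p k * c (S n - k)%nat)%C n) <=
                 Cmod (c O) * (A * M ^ S n) * sum_n (fun k => 2 ^ k) n)%R).
    { apply Rle_trans with (1 := Cmod_sum_n_le _ _).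
      assert (G : forall k, (k <= n)%nat ->
        (Cmod (p k * c (S n - k)%nat)%C <= Cmod (c O) * (A * M ^ S n) * 2 ^ k)%R).
      { intros k Hk. rewrite Cmod_mult.
        apply Rle_trans with ((A * (2 * M) ^ k) * (Cmod (c O) * M ^ (S n - k)))%R.
        - apply Rmult_le_compat; try apply Cmod_ge_0; [apply IH | apply Hcn]; lia.
        - apply Req_le. rewrite Rpow_mult_distr.
          replace (M ^ S n)%R with (M ^ k * M ^ (S n - k))%R
            by (rewrite <- pow_add; f_equal; lia).
          ring. }
      enough (G' : forall m, (m <= n)%nat ->
        (sum_n (fun k => Cmod (p k * c (S n - k)%nat)%C) m <=
         Cmod (c O) * (A * M ^ S n) * sum_n (fun k => 2 ^ k) m)%R) by now apply G'.
      intros m. induction m as [|m IHm]; intros Hm.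
      - rewrite !sum_O. now apply G.
      - rewrite !sum_Sn. unfold plus; simpl AbelianMonoid.plus.
        rewrite Rmult_plus_distr_l. apply Rplus_le_compat; [apply IHm; lia | now apply G]. }
    apply Rle_trans with (1 := Rplus_le_compat _ _ _ _ (Ha (S n)) B).
    apply Req_le. rewrite Rpow_mult_distr, <- E. ring.
Qed.

(** The coefficients of the quotient solve the Cauchy product equations
    recursively and grow at most geometrically. *)
Lemma analytic_at_div f g z0 :
  analytic_at f z0 -> analytic_at g z0 -> g z0 <> 0 -> analytic_at (fun z => f z / g z) z0.
Proof.
  intros Hf Hg Hg0.
  destruct (analytic_at_neq_0 g z0 Hg Hg0) as (d & Hd & Hnz).
  destruct (power_series_common _ _ _ Hf Hg) as (r & a & c & Ha & Hc).
  assert (Hc0 : c O <> 0) by now rewrite <- (power_series_center _ _ _ _ Hc).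
  assert (Hcp : (0 < Cmod (c O))%R) by now apply Cmod_gt_0.
  assert (Hr : (0 < r)%R) by apply Ha.
  assert (Bd : forall h b, power_series_at h z0 r b ->
     exists B, (0 <= B)%R /\ forall n, (Cmod (b n) * (r / 2) ^ n <= B)%R).
  { intros h b Hb. assert (E : z0 + (r / 2)%R - z0 = (r / 2)%R) by ring.
    destruct (C_series_bounded _ _ (proj2 Hb (z0 + (r / 2)%R)
      ltac:(rewrite E, Cmod_R, Rabs_pos_eq; lra))) as [B HB].
    assert (HB' : forall n, (Cmod (b n) * (r / 2) ^ n <= B)%R).
    { intros n. specialize (HB n). rewrite E, Cmod_mult, Cmod_pow, Cmod_R in HB.
      now rewrite (Rabs_pos_eq (r / 2)) in HB by lra. }
    exists B. split; [|exact HB']. specialize (HB' O). simpl in HB'.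
    generalize (Cmod_ge_0 (b O)). lra. }
  destruct (Bd _ _ Ha) as (Ba & HBa & HBa'). destruct (Bd _ _ Hc) as (Bc & HBc & HBc').
  (* [N >= 1] gives [N^n >= 1] for the bound on [a] and [N^n >= N] for [c]. *)
  set (N := Rmax 1 (Bc / Cmod (c O))). set (M := (N / (r / 2))%R).
  assert (HN1 : (1 <= N)%R) by apply Rmax_l.
  assert (HN2 : (Bc <= Cmod (c O) * N)%R).
  { apply Rle_trans with (Cmod (c O) * (Bc / Cmod (c O)))%R.
    - apply Req_le. field. lra.
    - apply Rmult_le_compat_l; [lra | apply Rmax_r]. }
  assert (HM : (0 < M)%R) by (apply Rdiv_lt_0_compat; lra).
  assert (HMn : forall n, (M ^ n * (r / 2) ^ n = N ^ n)%R).
  { intros n. rewrite <- Rpow_mult_distr. f_equal. unfold M. field. lra. }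
  assert (Hrp : forall n, (0 < (r / 2) ^ n)%R) by (intros; apply pow_lt; lra).
  destruct (quotient_coeff_exists a c Hc0) as (p & Hp0 & HpS).
  assert (Hp : forall n, (Cmod (p n) <= Ba / Cmod (c O) * (2 * M) ^ n)%R).
  { apply (quotient_coeff_bound a c); try assumption.
    - apply Rmult_le_pos; [exact HBa|]. apply Rlt_le, Rinv_0_lt_compat, Hcp.
    - lra.
    - intros n. apply Rmult_le_reg_r with (1 := Hrp n).
      apply Rle_trans with (1 := HBa' n).
      replace (Cmod (c O) * (Ba / Cmod (c O) * M ^ n) * (r / 2) ^ n)%R
        with (Ba * (M ^ n * (r / 2) ^ n))%R by (field; lra).
      rewrite HMn. rewrite <- (Rmult_1_r Ba) at 1.
      apply Rmult_le_compat_l; [exact HBa|]. now apply pow_R1_Rle.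
    - intros n Hn. apply Rmult_le_reg_r with (1 := Hrp n).
      apply Rle_trans with (1 := HBc' n). rewrite Rmult_assoc, HMn.
      apply Rle_trans with (1 := HN2). apply Rmult_le_compat_l; [lra|].
      rewrite <- (pow_1 N) at 1. apply Rle_pow; [exact HN1 | lia]. }
  set (s := Rmin (Rmin r d) (/ (2 * M))).
  assert (Hs : (0 < s)%R).
  { repeat apply Rmin_pos; try assumption. apply Rinv_0_lt_compat. lra. }
  exists s, p. split; [exact Hs|]. intros z Hz.
  assert (Hz1 := Rlt_le_trans _ _ _ Hz (Rmin_l _ _)).
  assert (Hz2 := Rlt_le_trans _ _ _ Hz (Rmin_r _ _)).
  assert (Hz3 := Rlt_le_trans _ _ _ Hz1 (Rmin_l _ _)).
  assert (Hz4 := Rlt_le_trans _ _ _ Hz1 (Rmin_r _ _)).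
  set (x := z - z0) in *. assert (Hx := Cmod_ge_0 x).
  assert (Ap : ex_series (fun n => Cmod (p n * x ^ n))).
  { apply (ex_series_le (V := R_CompleteNormedModule) _
      (fun n => (Ba / Cmod (c O)) * (2 * M * Cmod x) ^ n)%R).
    - intros n. change (Rabs (Cmod (p n * x ^ n)) <= Ba / Cmod (c O) * (2 * M * Cmod x) ^ n)%R.
      rewrite Rabs_pos_eq by apply Cmod_ge_0.
      rewrite Cmod_mult, Cmod_pow, Rpow_mult_distr, <- Rmult_assoc.
      apply Rmult_le_compat_r; [apply pow_le, Hx | apply Hp].
    - apply (ex_series_scal_l (V := R_NormedModule)). apply ex_series_geom.
      rewrite Rabs_pos_eq by (apply Rmult_le_pos; lra).
      apply Rmult_lt_reg_l with (/ (2 * M))%R; [apply Rinv_0_lt_compat; lra|].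
      rewrite <- Rmult_assoc, Rinv_l by lra. lra. }
  destruct (C_series_of_norm _ Ap) as [h Hh].
  assert (Hm := C_series_mult _ _ _ _ Hh (proj2 Hc z Hz3) Ap
     (power_series_abs_conv _ _ _ _ _ Hc Hz3)).
  fold x in Hm.
  apply (C_series_ext _ (fun n => a n * x ^ n)) in Hm.
  - rewrite (C_series_unique _ _ _ (proj2 Ha z Hz3) Hm).
    replace (h * g z / g z) with h; [exact Hh|]. field. now apply Hnz.
  - intros n. rewrite C_sum_n_convolution. f_equal. destruct n as [|n].
    + rewrite sum_O, Hp0. simpl. field. exact Hc0.
    + rewrite sum_Sn, Nat.sub_diag, HpS.
      change (C_sum_n (fun k => p k * c (S n - k)%nat) n +
        (a (S n) - C_sum_n (fun k => p k * c (S n - k)%nat) n) / c O * c O = a (S n)).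
      field. exact Hc0.
Qed.

(** * Maximum principle and the Schwarz-Pick inequality *)

(** Second-order expansion with a cubic error, the form in which analyticity
    enters the maximum principle. *)
Lemma power_series_taylor2 f z0 :
  analytic_at f z0 ->
  exists a0 a1 a2 : C, exists K eta : R, (0 < eta)%R /\ (0 <= K)%R /\
    forall h, (Cmod h < eta)%R ->
      (Cmod (f (z0 + h)%C - (a0 + a1 * h + a2 * h ^ 2)) <= K * Cmod h ^ 3)%R.
Proof.
  intros (r & a & H). assert (Hr : (0 < r)%R) by apply H.
  assert (Hb : ex_series (fun n => Cmod (a (S (S (S n)))) * (r / 2) ^ n)%R).
  { assert (E : ex_series (fun n => Cmod (a n) * (r / 2) ^ n)%R).
    { apply ex_series_Rabs. apply CV_disk_inside.
      apply (radius_le_CV_radius _ _ _ _ _ H). lra. }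
    apply (ex_series_incr_n (V := R_NormedModule) _ 3) in E.
    apply (ex_series_ext (fun n => / (r / 2) ^ 3 * (Cmod (a (3 + n)%nat) * (r / 2) ^ (3 + n)))%R).
    - intros n. rewrite pow_add. change (S (S (S n))) with (3 + n)%nat.
      match goal with |- ?x = ?y => change (@eq R x y) end. field. lra.
    - now apply (ex_series_scal_l (V := R_NormedModule)). }
  destruct Hb as [K HK].
  exists (a 0%nat), (a 1%nat), (a 2%nat), K, (r / 2)%R.
  split; [lra|]. split.
  { assert (Z := Cmod_series_le _ _ _ _ C_series_0 HK). rewrite Cmod_0 in Z. apply Z.
    intros n. rewrite Cmod_0. apply Rmult_le_pos; [apply Cmod_ge_0 | apply pow_le; lra]. }
  intros h Hh. assert (Hh0 := Cmod_ge_0 h).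
  assert (E : z0 + h - z0 = h) by ring.
  assert (S1 := proj2 H (z0 + h) ltac:(rewrite E; lra)). rewrite E in S1.
  apply C_series_shift, C_series_shift, C_series_shift in S1. cbv beta in S1.
  apply (Cmod_series_le _ (fun n => Cmod h ^ 3 * (Cmod (a (S (S (S n)))) * (r / 2) ^ n))%R _ (Cmod h ^ 3 * K)%R) in S1.
  - rewrite Rmult_comm.
    replace (f (z0 + h) - (a 0%nat + a 1%nat * h + a 2%nat * h ^ 2)) with
      (f (z0 + h) - a 0%nat * h ^ 0 - a 1%nat * h ^ 1 - a 2%nat * h ^ 2).
    exact S1. simpl. ring.
  - apply (is_series_scal_l (V := R_NormedModule)). exact HK.
  - intros n. rewrite Cmod_mult, Cmod_pow. change (S (S (S n))) with (3 + n)%nat.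
    rewrite pow_add.
    assert (P : (Cmod h ^ n <= (r / 2) ^ n)%R) by (apply pow_incr; lra).
    assert (P3 : (0 <= Cmod h ^ 3)%R) by now apply pow_le.
    replace (Cmod h ^ 3 * (Cmod (a (3 + n)%nat) * (r / 2) ^ n))%R
      with (Cmod (a (3 + n)%nat) * (Cmod h ^ 3 * (r / 2) ^ n))%R by ring.
    apply Rmult_le_compat_l; [apply Cmod_ge_0|].
    apply Rmult_le_compat_l; assumption.
Qed.

Lemma Cmod_sq_perturb (w g : C) : (Cmod g ^ 2 - 2 * Cmod g * Cmod (w - g) <= Cmod w ^ 2)%R.
Proof.
  assert (T : (Cmod g <= Cmod w + Cmod (w - g))%R).
  { replace g with (w + - (w - g)) at 1 by ring.
    apply Rle_trans with (1 := Cmod_triangle _ _). rewrite Cmod_opp. lra. }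
  revert T. generalize (Cmod_ge_0 g) (Cmod_ge_0 w) (Cmod_ge_0 (w - g)).
  generalize (Cmod g) (Cmod w) (Cmod (w - g)). intros x y e Hx Hy He T.
  destruct (Rle_dec e x); simpl; nra.
Qed.

(** Averaging over the fourth roots of unity isolates the Laplacian of
    [|F|^2 + eps |z|^2], which is [4 |F'|^2 + 4 eps > 0]. *)
Lemma no_local_max (F : C -> C) (eps d : R) (z0 : C) :
  analytic_at F z0 -> (0 < eps)%R -> (0 < d)%R ->
  exists z, (Cmod (z - z0) < d)%R /\
    (Cmod (F z0) ^ 2 + eps * Cmod z0 ^ 2 < Cmod (F z) ^ 2 + eps * Cmod z ^ 2)%R.
Proof.
  intros HF He Hd.
  destruct (power_series_taylor2 F z0 HF) as (a0 & a1 & a2 & K & eta & Heta & HK0 & HK).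
  assert (E0 : F z0 = a0).
  { specialize (HK 0). rewrite Cmod_0 in HK. specialize (HK Heta).
    rewrite Cplus_0_r in HK.
    apply Ceq_minus, Cmod_eq_0. apply Rle_antisym; [|apply Cmod_ge_0].
    replace (F z0 - a0) with (F z0 - (a0 + a1 * 0 + a2 * 0 ^ 2)) by (simpl; ring).
    eapply Rle_trans; [exact HK|]. simpl. lra. }
  set (B := (Cmod a0 + Cmod a1 + Cmod a2)%R).
  assert (HB : (0 <= B)%R).
  { unfold B. generalize (Cmod_ge_0 a0) (Cmod_ge_0 a1) (Cmod_ge_0 a2). lra. }
  assert (HBK : (0 <= B * K)%R) by now apply Rmult_le_pos.
  (* The last constraint makes the cubic error smaller than the gain
     [eps t^2] of the term [eps |z|^2]. *)
  set (t0 := Rmin (Rmin eta d) (Rmin 1 (eps / (2 * (B * K) + 1)))).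
  assert (Ht0 : (0 < t0)%R).
  { repeat apply Rmin_pos; try assumption; [lra|]. apply Rdiv_lt_0_compat; lra. }
  set (t := (t0 / 2)%R). assert (Ht : (0 < t < t0)%R) by (unfold t; lra).
  assert (Ht1 : (t < eta)%R).
  { apply Rlt_le_trans with t0; [lra|]. eapply Rle_trans; apply Rmin_l. }
  assert (Ht2 : (t < d)%R).
  { apply Rlt_le_trans with t0; [lra|]. eapply Rle_trans; [apply Rmin_l | apply Rmin_r]. }
  assert (Ht3 : (t < 1)%R).
  { apply Rlt_le_trans with t0; [lra|]. eapply Rle_trans; [apply Rmin_r | apply Rmin_l]. }
  assert (Ht4 : (2 * (B * K) * t < eps)%R).
  { assert (L : (t < eps / (2 * (B * K) + 1))%R).
    { apply Rlt_le_trans with t0; [lra|]. eapply Rle_trans; apply Rmin_r. }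
    apply Rlt_div_r in L; lra. }
  set (G := fun h : C => a0 + a1 * h + a2 * h ^ 2).
  assert (L : forall h, Cmod h = t ->
     (Cmod (G h) ^ 2 - 2 * (B * K) * t ^ 3 <= Cmod (F (z0 + h)%C) ^ 2)%R).
  { intros h Hh. eapply Rle_trans; [|apply (Cmod_sq_perturb _ (G h))].
    specialize (HK h). rewrite Hh in HK. specialize (HK Ht1). fold (G h) in HK.
    assert (HG : (Cmod (G h) <= B)%R).
    { unfold G, B. eapply Rle_trans; [apply Cmod_triangle|].
      eapply Rle_trans; [apply Rplus_le_compat_r, Cmod_triangle|].
      rewrite !Cmod_mult, Cmod_pow, Hh. simpl.
      generalize (Cmod_ge_0 a0) (Cmod_ge_0 a1) (Cmod_ge_0 a2). intros.
      assert (t * (t * 1) <= 1)%R by nra. nra. }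
    assert (Cmod (G h) * Cmod (F (z0 + h)%C - G h) <= B * (K * t ^ 3))%R.
    { apply Rmult_le_compat; try apply Cmod_ge_0; assumption. }
    lra. }
  assert (SG : (Cmod (G t) ^ 2 + Cmod (G (- t)%C) ^ 2 + Cmod (G (Ci * t)%C) ^ 2 + Cmod (G (- (Ci * t))%C) ^ 2
     = 4 * (Cmod a0 ^ 2 + Cmod a1 ^ 2 * t ^ 2 + Cmod a2 ^ 2 * t ^ 4))%R).
  { rewrite !Cmod2_alt. unfold G, Re, Im. destruct a0, a1, a2. simpl. ring. }
  assert (SZ : (Cmod (z0 + t) ^ 2 + Cmod (z0 + - t) ^ 2 + Cmod (z0 + Ci * t) ^ 2 + Cmod (z0 + - (Ci * t)) ^ 2
     = 4 * (Cmod z0 ^ 2 + t ^ 2))%R).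
  { rewrite !Cmod2_alt. unfold Re, Im. destruct z0. simpl. ring. }
  assert (M1 : Cmod t = t) by (rewrite Cmod_R; apply Rabs_pos_eq; lra).
  assert (M2 : Cmod (- t) = t) by now rewrite Cmod_opp.
  assert (M3 : Cmod (Ci * t) = t) by (rewrite Cmod_mult, Cmod_Ci, M1; ring).
  assert (M4 : Cmod (- (Ci * t)) = t) by now rewrite Cmod_opp.
  apply NNPP. intros N.
  assert (U : forall h, Cmod h = t ->
    (Cmod (F (z0 + h)%C) ^ 2 + eps * Cmod (z0 + h) ^ 2 <= Cmod a0 ^ 2 + eps * Cmod z0 ^ 2)%R).
  { intros h Hh. apply Rnot_lt_le. intros Hlt. apply N. exists (z0 + h).
    replace (z0 + h - z0) with h by ring. rewrite Hh, E0. now split. }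
  assert (U1 := U _ M1). assert (U2 := U _ M2). assert (U3 := U _ M3). assert (U4 := U _ M4).
  assert (L1 := L _ M1). assert (L2 := L _ M2). assert (L3 := L _ M3). assert (L4 := L _ M4).
  clear U L N.
  assert (P1 : (0 <= Cmod a1 ^ 2 * t ^ 2)%R) by (apply Rmult_le_pos; apply pow2_ge_0).
  assert (P2 : (0 <= Cmod a2 ^ 2 * t ^ 4)%R) by (apply Rmult_le_pos; [apply pow2_ge_0 | apply pow_le; lra]).
  assert (P3 : (2 * (B * K) * t ^ 3 < eps * t ^ 2)%R).
  { replace (2 * (B * K) * t ^ 3)%R with ((2 * (B * K) * t) * t ^ 2)%R by ring.
    apply Rmult_lt_compat_r; [apply pow_lt; lra | exact Ht4]. }
  assert (SZ' : (eps * Cmod (z0 + t) ^ 2 + eps * Cmod (z0 + - t) ^ 2 + eps * Cmod (z0 + Ci * t) ^ 2 + eps * Cmod (z0 + - (Ci * t)) ^ 2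
     = 4 * (eps * Cmod z0 ^ 2 + eps * t ^ 2))%R).
  { rewrite <- !Rmult_plus_distr_l, SZ. ring. }
  lra.
Qed.

Lemma list_argmax {T : Type} (g : T -> R) (l : list T) :
  l <> nil -> exists t, In t l /\ forall s, In s l -> (g s <= g t)%R.
Proof.
  induction l as [|x l IH]; [easy|]. intros _.
  destruct l as [|y l].
  - exists x. split; [now left|]. intros s [->|[]]. apply Rle_refl.
  - destruct IH as (t & Ht & Hmax); [easy|].
    destruct (Rle_dec (g x) (g t)) as [Hle|Hgt].
    + exists t. split; [now right|]. intros s [->|Hs]; [exact Hle | now apply Hmax].
    + exists x. split; [now left|]. intros s [->|Hs]; [apply Rle_refl|].
      specialize (Hmax s Hs). lra.
Qed.

(** If no maximum existed, each point would have a neighbourhood on which [u] is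
    below some value [u z'] taken in the disk; a finite subcover bounds [u] by the
    largest of these values, which is itself one of the values of [u]. *)
Lemma closed_disk_argmax (u : C -> R) (rho : R) :
  (0 <= rho)%R ->
  (forall z, Cmod z <= rho -> forall eps, 0 < eps -> exists d, 0 < d /\
     forall w, Cmod (w - z)%C < d -> u w < u z + eps)%R ->
  exists z, (Cmod z <= rho)%R /\ forall w, (Cmod w <= rho)%R -> (u w <= u z)%R.
Proof.
  intros Hrho Hu. apply NNPP. intros N.
  assert (Q : forall z, exists p : posreal * C, (Cmod (snd p) <= rho)%R /\
    forall w, (Cmod w <= rho)%R -> (Cmod (w - z)%C < 2 * fst p)%R -> (u w < u (snd p))%R).
  { intros z. destruct (Rle_dec (Cmod z) rho) as [Hz|Hz].
    - assert (exists z', (Cmod z' <= rho)%R /\ (u z < u z')%R) as (z' & Hz' & Huz).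
      { apply NNPP. intros N'. apply N. exists z. split; [exact Hz|].
        intros w Hw. apply Rnot_lt_le. intros Hlt. apply N'. now exists w. }
      destruct (Hu z Hz (u z' - u z)%R) as (d & Hd & Hw); [lra|].
      assert (Hd2 : (0 < d / 2)%R) by lra.
      exists (mkposreal _ Hd2, z'). split; [exact Hz'|]. simpl. intros w _ Hwz.
      specialize (Hw w). lra.
    - assert (Hd2 : (0 < (Cmod z - rho) / 2)%R) by lra.
      exists (mkposreal _ Hd2, RtoC 0). split; [simpl; now rewrite Cmod_0|]. simpl.
      intros w Hw Hwz. exfalso.
      assert (T : (Cmod z <= Cmod w + Cmod (w - z))%R).
      { replace z with (w + - (w - z)) at 1 by ring.
        apply Rle_trans with (1 := Cmod_triangle _ _). rewrite Cmod_opp. lra. }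
      lra. }
  pose (sel := fun z => proj1_sig (constructive_indefinite_description _ (Q z))).
  assert (Hsel : forall z, (Cmod (snd (sel z)) <= rho)%R /\
    forall w, (Cmod w <= rho)%R -> (Cmod (w - z)%C < 2 * fst (sel z))%R -> (u w < u (snd (sel z)))%R).
  { intros z. apply (proj2_sig (constructive_indefinite_description _ (Q z))). }
  clearbody sel. clear Q N Hu.
  (* The compactness lemma speaks of a square, which is why [sel] is also
     defined outside the disk: there the neighbourhood misses the disk. *)
  pose (toC := fun x : Compactness.Tn 2 R => (fst x, fst (snd x)) : C).
  apply (compactness_list 2 ((-rho)%R, ((-rho)%R, tt)) (rho, (rho, tt)) (fun x => fst (sel (toC x)))).
  intros [l Hl].
  assert (Cov : forall w, (Cmod w <= rho)%R -> exists t, In t l /\ (u w < u (snd (sel (toC t))))%R).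
  { intros w Hw.
    assert (R1 := Rle_trans _ _ _ (re_le_Cmod w) Hw). assert (R2 := Rle_trans _ _ _ (im_le_Cmod w) Hw).
    apply Rabs_le_between in R1, R2.
    destruct (Hl (fst w, (snd w, tt))) as (t & Ht & _ & Hc).
    { simpl. unfold Re, Im in *. tauto. }
    exists t. split; [exact Ht|]. apply (proj2 (Hsel (toC t))); [exact Hw|].
    destruct t as [t1 [t2 []]]. unfold toC in *. simpl fst in *. simpl snd in *.
    simpl in Hc. destruct Hc as (C1 & C2 & _).
    eapply Rle_lt_trans; [apply Cmod_2Rmax|]. simpl.
    apply Rle_lt_trans with (2 * Rmax (Rabs (fst w + - t1)) (Rabs (snd w + - t2)))%R.
    - apply Rmult_le_compat_r.
      + eapply Rle_trans; [apply Rabs_pos | apply Rmax_l].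
      + apply Rle_trans with (sqrt (2 * 2)); [apply sqrt_le_1_alt | rewrite sqrt_square]; lra.
    - apply Rmult_lt_compat_l; [lra|]. apply Rmax_lub_lt; assumption. }
  destruct (list_argmax (fun t => u (snd (sel (toC t)))) l) as (t & Ht & Hmax).
  { intros ->. destruct (Cov 0) as (t & [] & _). now rewrite Cmod_0. }
  destruct (Cov (snd (sel (toC t))) (proj1 (Hsel _))) as (s & Hs & Hlt).
  specialize (Hmax s Hs). simpl in Hmax. lra.
Qed.

Lemma sq_upper_semicontinuous (x eps : R) :
  (0 <= x)%R -> (0 < eps)%R ->
  exists d, (0 < d)%R /\ forall y, (0 <= y < x + d)%R -> (y ^ 2 < x ^ 2 + eps)%R.
Proof.
  intros Hx He. exists (Rmin 1 (eps / (2 * x + 2))). split.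
  { apply Rmin_pos; [lra|]. apply Rdiv_lt_0_compat; lra. }
  intros y Hy. set (d := Rmin _ _) in *.
  assert (H1 : (d <= 1)%R) by apply Rmin_l.
  assert (H2 : (d * (2 * x + 2) <= eps)%R).
  { assert (H2 : (d <= eps / (2 * x + 2))%R) by apply Rmin_r.
    apply Rle_div_r in H2; lra. }
  assert (H3 : (0 < d)%R).
  { apply Rmin_pos; [lra|]. apply Rdiv_lt_0_compat; lra. }
  clearbody d. simpl.
  assert (y * y <= (x + d) * (x + d))%R by (apply Rmult_le_compat; lra).
  assert (d * d <= d * 1)%R by (apply Rmult_le_compat_l; lra).
  nra.
Qed.

Lemma Cmod_near (w z : C) (d : R) : (Cmod (w - z) < d)%R -> (0 <= Cmod w < Cmod z + d)%R.
Proof.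
  intros H. split; [apply Cmod_ge_0|].
  replace w with (z + (w - z)) at 1 by ring.
  apply Rle_lt_trans with (1 := Cmod_triangle _ _). lra.
Qed.

(** The boundary condition is only asymptotic because an analytic function on the
    open disk has no boundary values. A maximum of [|F|^2 + eps |z|^2] on a closed
    disk lies on its boundary by [no_local_max]. *)
Lemma maximum_principle (F : C -> C) :
  (forall z, in_disk z -> analytic_at F z) ->
  (forall eps, 0 < eps -> exists rho, rho < 1 /\
     forall z, rho <= Cmod z < 1 -> Cmod (F z) ^ 2 <= 1 + eps)%R ->
  forall z, in_disk z -> (Cmod (F z) <= 1)%R.
Proof.
  intros HF Hb z1 Hz1. unfold in_disk in *.
  assert (Hsq : (Cmod (F z1) ^ 2 <= 1)%R).
  { apply le_epsilon. intros eps' Heps'. set (eps := (eps' / 2)%R).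
    assert (He : (0 < eps)%R) by (unfold eps; lra).
    destruct (Hb eps He) as (rho0 & Hrho0 & Hbd).
    set (rho := Rmax rho0 (Cmod z1)).
    assert (Hrho : (rho < 1)%R) by now apply Rmax_lub_lt.
    assert (Hr1 : (Cmod z1 <= rho)%R) by apply Rmax_r.
    assert (Hr0 : (rho0 <= rho)%R) by apply Rmax_l.
    destruct (closed_disk_argmax (fun z => Cmod (F z) ^ 2 + eps * Cmod z ^ 2)%R rho)
      as (m & Hm & Hmax).
    { generalize (Cmod_ge_0 z1). lra. }
    { intros z Hz e Hepos.
      destruct (sq_upper_semicontinuous (Cmod (F z)) (e / 2)) as (d1 & Hd1 & H1);
        [apply Cmod_ge_0 | lra |].
      destruct (sq_upper_semicontinuous (Cmod z) (e / 2 / eps)) as (d2 & Hd2 & H2);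
        [apply Cmod_ge_0 | apply Rdiv_lt_0_compat; lra |].
      destruct (analytic_at_continuous F z d1) as (d3 & Hd3 & H3);
        [apply HF; lra | exact Hd1 |].
      exists (Rmin d2 d3). split; [now apply Rmin_pos|]. intros w Hw.
      specialize (H3 w (Rlt_le_trans _ _ _ Hw (Rmin_r _ _))).
      specialize (H1 _ (Cmod_near _ _ _ H3)).
      specialize (H2 _ (Cmod_near _ _ _ (Rlt_le_trans _ _ _ Hw (Rmin_l _ _)))).
      apply (Rmult_lt_compat_l eps) in H2; [|exact He].
      replace (eps * (Cmod z ^ 2 + e / 2 / eps))%R with (eps * Cmod z ^ 2 + e / 2)%R in H2
        by (field; lra).
      lra. }
    simpl in Hmax.
    destruct (Rle_lt_or_eq_dec _ _ Hm) as [Hlt|Heq].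
    - exfalso. destruct (no_local_max F eps (rho - Cmod m) m) as (w & Hw & Hgt);
        [apply HF; lra | exact He | lra |].
      apply (Rlt_not_le _ _ Hgt). apply Hmax.
      destruct (Cmod_near _ _ _ Hw). lra.
    - specialize (Hmax z1 Hr1). specialize (Hbd m).
      assert (Cmod m * (Cmod m * 1) <= 1)%R by (generalize (Cmod_ge_0 m); nra).
      assert (0 <= Cmod z1 * (Cmod z1 * 1))%R by (generalize (Cmod_ge_0 z1); nra).
      simpl in *. unfold eps in *. nra. }
  generalize (Cmod_ge_0 (F z1)). simpl in Hsq. nra.
Qed.

Definition difference_quotient (f : C -> C) (a z : C) : C :=
  if Ceq_dec z a then C_derive f a else (f z - f a) / (z - a).

Lemma C_series_at_0 (c : nat -> C) : C_series (fun n => c n * 0 ^ n) (c O).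
Proof.
  rewrite <- (Cplus_0_r (c O)).
  apply (C_series_ext (fun n => match n with O => c O | S _ => RtoC 0 end)).
  - intros [|n]; rewrite ?Cpow_S; simpl; ring.
  - apply (C_series_unshift (fun n => match n with O => c O | S _ => RtoC 0 end)), C_series_0.
Qed.

(** At [a] the power series of the quotient is the shifted series of [f]. *)
Lemma analytic_at_difference_quotient f a z0 :
  analytic_at f a -> analytic_at f z0 -> analytic_at (difference_quotient f a) z0.
Proof.
  intros Ha Hz. destruct (Ceq_dec z0 a) as [->|Hne].
  - destruct Ha as (r & c & Hc). exists r, (fun n => c (S n)).
    split; [apply Hc|]. intros z Hzr. unfold difference_quotient.
    destruct (Ceq_dec z a) as [->|Hza].
    + replace (a - a) with (RtoC 0) by ring.
      replace (C_derive f a) with (c 1%nat); [apply (C_series_at_0 (fun n => c (S n)))|].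
      rewrite (power_series_coeff _ _ _ _ 1 Hc). simpl. field.
    + assert (Hx : z - a <> 0) by now apply Cminus_eq_contra.
      assert (S1 := C_series_scal (/ (z - a)) _ _ (C_series_shift _ _ (proj2 Hc z Hzr))).
      cbv beta in S1. replace ((f z - f a) / (z - a)) with (/ (z - a) * (f z - c 0%nat * (z - a) ^ 0)).
      * apply C_series_ext with (2 := S1). intros n. rewrite Cpow_S. field. exact Hx.
      * rewrite (power_series_center _ _ _ _ Hc). simpl. field. exact Hx.
  - assert (Hd : (0 < Cmod (z0 - a))%R) by now apply Cmod_gt_0, Cminus_eq_contra.
    apply (analytic_at_ext (fun z => (f z - (f a + 0 * z)) / (- a + 1 * z)) _ _ _ Hd).
    + intros z Hzd. unfold difference_quotient. destruct (Ceq_dec z a) as [->|Hza].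
      * exfalso. rewrite <- Cmod_opp in Hzd. replace (- (a - z0)) with (z0 - a) in Hzd by ring. lra.
      * f_equal; ring.
    + apply analytic_at_div.
      * apply analytic_at_minus; [exact Hz | apply analytic_at_affine].
      * apply analytic_at_affine.
      * replace (- a + 1 * z0) with (z0 - a) by ring. now apply Cminus_eq_contra.
Qed.

(** Shows at once that the Blaschke factor [(z - a) / (1 - conj a z)] maps the
    disk into itself and that its modulus tends to [1] at the boundary. *)
Lemma blaschke_identity (a z : C) :
  (Cmod (1 - Cconj a * z) ^ 2 =
   Cmod (z - a) ^ 2 + (1 - Cmod z ^ 2) * (1 - Cmod a ^ 2))%R.
Proof. rewrite !Cmod2_alt. destruct a, z. unfold Re, Im. simpl. ring. Qed.

Lemma Cmod_sq_lt_1 z : in_disk z -> (Cmod z ^ 2 < 1)%R.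
Proof. unfold in_disk. intros H. generalize (Cmod_ge_0 z). simpl. nra. Qed.

Lemma blaschke_denominator_neq_0 (a z : C) :
  in_disk a -> in_disk z -> 1 - Cconj a * z <> 0.
Proof.
  intros Ha%Cmod_sq_lt_1 Hz%Cmod_sq_lt_1 E. assert (I := blaschke_identity a z).
  rewrite E, Cmod_0 in I. generalize (pow2_ge_0 (Cmod (z - a))). simpl in *. nra.
Qed.

(** Blaschke factor of [w z] at [w a] divided by that of [z] at [a], with the
    singularity at [a] removed. *)
Definition pick_quotient (w : C -> C) (a z : C) : C :=
  difference_quotient w a z * ((1 - Cconj a * z) / (1 - Cconj (w a) * w z)).

Lemma pick_quotient_le_1 (w : C -> C) (a : C) :
  analytic_on_disk w -> (forall z, in_disk z -> in_disk (w z)) -> in_disk a ->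
  forall z, in_disk z -> (Cmod (pick_quotient w a z) <= 1)%R.
Proof.
  intros Hw Hmap Ha. apply maximum_principle.
  - intros z Hz. apply analytic_at_mult.
    + apply analytic_at_difference_quotient; now apply analytic_on_disk_at.
    + apply (analytic_at_ext (fun z => (1 + (- Cconj a) * z) / ((1 + 0 * z) - (Cconj (w a) + 0 * z) * w z)) _ z 1 Rlt_0_1).
      * intros y _. f_equal; ring.
      * apply analytic_at_div.
        -- apply analytic_at_affine.
        -- apply analytic_at_minus; [apply analytic_at_affine|].
           apply analytic_at_mult; [apply analytic_at_affine | now apply analytic_on_disk_at].
        -- replace (1 + 0 * z - (Cconj (w a) + 0 * z) * w z) with (1 - Cconj (w a) * w z) by ring.
           apply blaschke_denominator_neq_0; now apply Hmap.
  - intros eps He. unfold in_disk in Ha.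
    set (d := ((1 - Cmod a) / 2)%R). assert (Hd : (0 < d)%R) by (unfold d; lra).
    (* Beyond the first radius [|z - a| >= d]; beyond the second one
       [1 - |z|^2 <= eps d^2]. *)
    exists (Rmax (1 - d) (1 - eps * d ^ 2 / 2))%R. split.
    { assert (0 < eps * d ^ 2)%R by (apply Rmult_lt_0_compat; [lra | now apply pow_lt]).
      apply Rmax_lub_lt; lra. }
    intros z [Hz1 Hz2].
    assert (Hz3 := Rle_trans _ _ _ (Rmax_l _ _) Hz1). assert (Hz4 := Rle_trans _ _ _ (Rmax_r _ _) Hz1).
    assert (Hza : (d <= Cmod (z - a))%R).
    { assert (Cmod z <= Cmod (z - a) + Cmod a)%R.
      { replace z with ((z - a) + a) at 1 by ring. apply Cmod_triangle. }
      unfold d in *. lra. }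
    assert (Hne : z <> a).
    { intros ->. replace (a - a) with (RtoC 0) in Hza by ring. rewrite Cmod_0 in Hza. lra. }
    assert (Hd1 : 1 - Cconj (w a) * w z <> 0) by (apply blaschke_denominator_neq_0; now apply Hmap).
    assert (Hd2 : z - a <> 0) by now apply Cminus_eq_contra.
    unfold pick_quotient, difference_quotient. destruct (Ceq_dec z a) as [->|_]; [easy|].
    rewrite Cmod_mult, !Cmod_div by assumption.
    apply Cmod_gt_0 in Hd1, Hd2.
    assert (I1 := blaschke_identity a z). assert (I2 := blaschke_identity (w a) (w z)).
    assert (Ha2 := Cmod_sq_lt_1 a Ha). assert (Hzz := Cmod_sq_lt_1 z Hz2).
    assert (Hwa := Cmod_sq_lt_1 _ (Hmap a Ha)). assert (Hwz := Cmod_sq_lt_1 _ (Hmap z Hz2)).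
    set (N1 := Cmod (w z - w a)) in *. set (N2 := Cmod (1 - Cconj a * z)) in *.
    set (D1 := Cmod (z - a)) in *. set (D2 := Cmod (1 - Cconj (w a) * w z)) in *.
    assert (Q1 : (N1 ^ 2 <= D2 ^ 2)%R) by nra.
    assert (Q2 : (N2 ^ 2 <= (1 + eps) * D1 ^ 2)%R).
    { assert (d ^ 2 <= D1 ^ 2)%R by (apply pow_incr; lra).
      assert (1 - Cmod z ^ 2 <= eps * d ^ 2)%R by (simpl in *; nra).
      assert (0 <= Cmod a ^ 2)%R by apply pow2_ge_0.
      assert (eps * d ^ 2 <= eps * D1 ^ 2)%R by (apply Rmult_le_compat_l; lra).
      nra. }
    replace ((N1 / D1 * (N2 / D2)) ^ 2)%R with ((N1 ^ 2 * N2 ^ 2) / (D1 ^ 2 * D2 ^ 2))%R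
      by (field; lra).
    assert (0 < D1 ^ 2)%R by now apply pow_lt. assert (0 < D2 ^ 2)%R by now apply pow_lt.
    apply Rle_div_l; [now apply Rmult_lt_0_compat|].
    apply Rle_trans with (D2 ^ 2 * ((1 + eps) * D1 ^ 2))%R; [|apply Req_le; ring].
    apply Rmult_le_compat; try apply pow2_ge_0; assumption.
Qed.

(** The case [a = 0] of the bound on [pick_quotient]. *)
Lemma schwarz (w : C -> C) :
  analytic_on_disk w -> (forall z, in_disk z -> in_disk (w z)) -> w 0 = 0 ->
  forall z, in_disk z -> (Cmod (w z) <= Cmod z)%R.
Proof.
  intros Hw Hmap H0 z Hz.
  destruct (Ceq_dec z 0) as [->|Hne]; [rewrite H0; apply Rle_refl|].
  assert (D0 : in_disk 0) by (unfold in_disk; rewrite Cmod_0; lra).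
  assert (Q := pick_quotient_le_1 w 0 Hw Hmap D0 z Hz).
  unfold pick_quotient, difference_quotient in Q. rewrite H0 in Q.
  destruct (Ceq_dec z 0) as [|_]; [easy|].
  replace (Cconj 0) with (RtoC 0) in Q by (unfold Cconj, RtoC; simpl; f_equal; ring).
  replace ((w z - 0) / (z - 0) * ((1 - 0 * z) / (1 - 0 * w z))) with (w z / z) in Q.
  - rewrite Cmod_div in Q by exact Hne. apply Cmod_gt_0 in Hne. apply Rle_div_l in Q; lra.
  - replace (1 - 0 * z) with (RtoC 1) by ring. replace (1 - 0 * w z) with (RtoC 1) by ring.
    field. exact Hne.
Qed.

(** The bound on [pick_quotient] at the removed singularity [z = a]. *)
Lemma schwarz_pick (w : C -> C) :
  analytic_on_disk w -> (forall z, in_disk z -> in_disk (w z)) ->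
  forall z, in_disk z ->
  (Cmod (C_derive w z) * (1 - Cmod z ^ 2) <= 1 - Cmod (w z) ^ 2)%R.
Proof.
  intros Hw Hmap z Hz.
  assert (Q := pick_quotient_le_1 w z Hw Hmap Hz z Hz).
  unfold pick_quotient, difference_quotient in Q.
  destruct (Ceq_dec z z) as [_|]; [|easy].
  rewrite Cmod_mult, Cmod_div in Q by (apply blaschke_denominator_neq_0; now apply Hmap).
  assert (E : forall y, in_disk y -> Cmod (1 - Cconj y * y) = (1 - Cmod y ^ 2)%R).
  { intros y Hy. replace (1 - Cconj y * y) with (RtoC (1 - Cmod y ^ 2)%R).
    - rewrite Cmod_R. apply Rabs_pos_eq. generalize (Cmod_sq_lt_1 y Hy). lra.
    - rewrite RtoC_minus, Cmod2_conj. ring. }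
  rewrite !E in Q by (try apply Hmap; exact Hz).
  assert (Hp := Cmod_sq_lt_1 _ (Hmap z Hz)).
  unfold Rdiv in Q. rewrite <- Rmult_assoc in Q. apply Rle_div_l in Q; lra.
Qed.

(** * Majorants along the negative axis *)

(** Connectedness of the interval from 0 to 1 as an induction principle. *)
Lemma real_induction (P : R -> Prop) :
  P 0%R ->
  (forall t, 0 <= t < 1 -> P t -> exists d, 0 < d /\ forall s, t <= s < t + d -> P s)%R ->
  (forall t, 0 < t < 1 -> (forall s, 0 <= s < t -> P s) -> P t)%R ->
  forall t, (0 <= t < 1)%R -> P t.
Proof.
  intros P0 Hopen Hclosed T HT. apply NNPP. intros N.
  pose (E := fun x => (0 <= x <= T /\ forall s, 0 <= s <= x -> P s)%R).
  destruct (completeness E) as [S [Sub Slub]].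
  - exists T. intros x [Hx _]. lra.
  - exists 0%R. split; [lra|]. intros s Hs. now replace s with 0%R by lra.
  - assert (HST : (S <= T)%R) by (apply Slub; intros x [Hx _]; lra).
    assert (HS0 : (0 <= S)%R).
    { apply Sub. split; [lra|]. intros s Hs. now replace s with 0%R by lra. }
    assert (Hlt : forall s, (0 <= s < S)%R -> P s).
    { intros s Hs. apply NNPP. intros Ns. apply (Rlt_not_le S s); [lra|].
      apply Slub. intros x [Hx HPx]. apply Rnot_lt_le. intros Hsx. apply Ns, HPx. lra. }
    assert (HPS : P S).
    { destruct (Rle_lt_or_eq_dec _ _ HS0) as [HS|<-]; [|exact P0]. apply Hclosed; [lra | exact Hlt]. }
    assert (HSne : (S < T)%R).
    { destruct (Rle_lt_or_eq_dec _ _ HST) as [HS|HS]; [exact HS|]. now rewrite HS in HPS. }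
    destruct (Hopen S) as (d & Hd & Hstep); [lra | exact HPS |].
    set (x := Rmin T (S + d / 2)).
    assert (Hx1 : (x <= T)%R) by apply Rmin_l.
    assert (Hx2 : (x <= S + d / 2)%R) by apply Rmin_r.
    assert (Hx3 : (S < x)%R) by (apply Rmin_glb_lt; lra).
    apply (Rlt_not_le _ _ Hx3). apply Sub. split; [lra|]. intros s Hs.
    destruct (Rlt_dec s S) as [H|H]; [apply Hlt | apply Hstep]; lra.
Qed.

Lemma analytic_at_derive_n f n z : analytic_at f z -> analytic_at (C_derive_n f n) z.
Proof.
  intros H. induction n as [|n IH]; [exact H | apply (analytic_at_derive _ _ IH)].
Qed.

Lemma in_disk_scal (t : R) (u : C) : Cmod u = 1%R -> (0 <= t < 1)%R -> in_disk (t * u).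
Proof.
  intros Hu Ht. unfold in_disk. rewrite Cmod_mult, Cmod_R, Hu, Rabs_pos_eq; lra.
Qed.

(** By connectedness in [t]. The Taylor coefficients of the [n]-th derivative at a
    point of a ray are the higher derivatives there, so the inequalities for all
    orders at [t] give, term by term, the inequality of order [n] at all slightly
    larger parameters; continuity takes care of limits. *)
Lemma derivative_majorant (f : C -> C) (u v : C) :
  (forall z, in_disk z -> analytic_at f z) ->
  Cmod u = 1%R -> Cmod v = 1%R ->
  (forall n, Cmod (C_derive_n f n 0) <= Re (v ^ n * C_derive_n f n 0))%R ->
  forall t, (0 <= t < 1)%R -> forall n,
    (Cmod (C_derive_n f n (t * u)%C) <= Re (v ^ n * C_derive_n f n (t * v)%C))%R.
Proof.
  intros Hf Hu Hv H0. apply (real_induction (fun t => forall n,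
    (Cmod (C_derive_n f n (t * u)%C) <= Re (v ^ n * C_derive_n f n (t * v)%C))%R)).
  - intros n. rewrite !Cmult_0_l. apply H0.
  - intros t Ht IH.
    destruct (Hf (t * v)) as (r1 & a & Ha); [now apply in_disk_scal|].
    destruct (Hf (t * u)) as (r2 & b & Hb); [now apply in_disk_scal|].
    assert (Hr1 := proj1 Ha). assert (Hr2 := proj1 Hb).
    exists (Rmin r1 r2). split; [now apply Rmin_pos|]. intros s Hs n.
    assert (Hs1 : (s < t + r1)%R) by (generalize (Rmin_l r1 r2); lra).
    assert (Hs2 : (s < t + r2)%R) by (generalize (Rmin_r r1 r2); lra).
    assert (Ev : s * v - t * v = (s - t)%R * v) by (rewrite RtoC_minus; ring).
    assert (Eu : s * u - t * u = (s - t)%R * u) by (rewrite RtoC_minus; ring).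
    assert (Mst : Cmod (s - t)%R = (s - t)%R) by (rewrite Cmod_R; apply Rabs_pos_eq; lra).
    assert (Sf := taylor_series f _ _ _ n (s * v) Ha
      ltac:(rewrite Ev, Cmod_mult, Mst, Hv; lra)).
    assert (Sg := taylor_series f _ _ _ n (s * u) Hb
      ltac:(rewrite Eu, Cmod_mult, Mst, Hu; lra)).
    apply (C_series_scal (v ^ n)) in Sf. apply C_series_parts in Sf. destruct Sf as [Sf _].
    apply (Cmod_series_le _ _ _ _ Sg Sf). intros k. rewrite Ev, Eu.
    assert (Hfact : (0 < INR (fact k))%R) by apply INR_fact_lt_0.
    assert (Hfact' : RtoC (INR (fact k)) <> 0) by (intros E; apply RtoC_inj in E; lra).
    rewrite !Cpow_mult_l, <- RtoC_pow.
    replace (v ^ n * (C_derive_n f (k + n) (t * v) / INR (fact k) * (((s - t) ^ k)%R * v ^ k)))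
      with (((s - t) ^ k / INR (fact k))%R * (v ^ (k + n) * C_derive_n f (k + n) (t * v))).
    2: { rewrite RtoC_div by lra. rewrite Cpow_add_r. field. exact Hfact'. }
    rewrite re_scal_l, Cmod_mult, Cmod_div, Cmod_mult, Cmod_pow, Hu, pow1 by exact Hfact'.
    rewrite !Cmod_R, (Rabs_pos_eq (INR _)), (Rabs_pos_eq ((s - t) ^ k)) by (try apply pow_le; lra).
    replace (Cmod (C_derive_n f (k + n) (t * u)%C) / INR (fact k) * ((s - t) ^ k * 1))%R
      with ((s - t) ^ k / INR (fact k) * Cmod (C_derive_n f (k + n) (t * u)%C))%R
      by (field; lra).
    apply Rmult_le_compat_l; [|apply IH].
    apply Rmult_le_pos; [apply pow_le; lra | apply Rlt_le, Rinv_0_lt_compat, Hfact].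
  - intros t Ht IH n. apply Rnot_lt_le. intros Hlt.
    set (gt := C_derive_n f n (t * u)) in *. set (ft := C_derive_n f n (t * v)) in *.
    set (e := ((Cmod gt - Re (v ^ n * ft)) / 2)%R).
    assert (He : (0 < e)%R) by (unfold e; lra).
    destruct (analytic_at_continuous (C_derive_n f n) (t * v) e) as (d1 & Hd1 & K1);
      [apply analytic_at_derive_n, Hf, in_disk_scal; [exact Hv | lra] | exact He |].
    destruct (analytic_at_continuous (C_derive_n f n) (t * u) e) as (d2 & Hd2 & K2);
      [apply analytic_at_derive_n, Hf, in_disk_scal; [exact Hu | lra] | exact He |].
    set (d := Rmin t (Rmin d1 d2)).
    assert (Hd : (0 < d)%R) by (repeat apply Rmin_pos; lra).
    assert (Hdt : (d <= t)%R) by apply Rmin_l.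
    assert (Hdd1 : (d <= d1)%R) by (eapply Rle_trans; [apply Rmin_r | apply Rmin_l]).
    assert (Hdd2 : (d <= d2)%R) by (eapply Rle_trans; [apply Rmin_r | apply Rmin_r]).
    set (s := (t - d / 2)%R).
    assert (Mst : Cmod (s - t)%R = (d / 2)%R).
    { rewrite Cmod_R. unfold s. rewrite Rabs_left; lra. }
    assert (Ev : s * v - t * v = (s - t)%R * v) by (rewrite RtoC_minus; ring).
    assert (Eu : s * u - t * u = (s - t)%R * u) by (rewrite RtoC_minus; ring).
    specialize (K1 (s * v) ltac:(rewrite Ev, Cmod_mult, Mst, Hv; lra)).
    specialize (K2 (s * u) ltac:(rewrite Eu, Cmod_mult, Mst, Hu; lra)).
    fold ft in K1. fold gt in K2.
    assert (IHs := IH s ltac:(unfold s; lra) n).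
    set (gs := C_derive_n f n (s * u)) in *. set (fs := C_derive_n f n (s * v)) in *.
    assert (T1 : (Cmod gt <= Cmod gs + Cmod (gs - gt))%R).
    { replace gt with (gs + - (gs - gt)) at 1 by ring.
      apply Rle_trans with (1 := Cmod_triangle _ _). rewrite Cmod_opp. lra. }
    assert (T2 : (Re (v ^ n * fs) <= Re (v ^ n * ft) + Cmod (fs - ft))%R).
    { replace (v ^ n * fs) with (v ^ n * ft + v ^ n * (fs - ft)) by ring.
      rewrite re_plus. apply Rplus_le_compat_l.
      apply Rle_trans with (1 := Rle_abs _). apply Rle_trans with (1 := re_le_Cmod _).
      rewrite Cmod_mult, Cmod_pow, Hv, pow1. lra. }
    unfold e in *. lra.
Qed.

(** The sign condition makes [(-1)^n] times the [n]-th derivative at [0] a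
    non-negative real number, so this is in fact an equality. *)
Lemma alternating_derivatives (f : C -> C) n :
  odd_nonpos_even_nonneg f ->
  (Cmod (C_derive_n f n 0) <= Re ((- (1)) ^ n * C_derive_n f n 0))%R.
Proof.
  intros H. destruct (H n) as [Hodd Heven].
  assert (Hfact : (0 < INR (fact n))%R) by apply INR_fact_lt_0.
  assert (Hfact' : RtoC (INR (fact n)) <> 0) by (intros E; apply RtoC_inj in E; lra).
  replace (C_derive_n f n 0) with (INR (fact n) * taylor_coeff f n)
    by (unfold taylor_coeff; field; exact Hfact').
  set (c := taylor_coeff f n) in *.
  replace ((- (1)) ^ n * (INR (fact n) * c)) with (INR (fact n) * ((- (1)) ^ n * c)) by ring.
  rewrite re_scal_l, Cmod_mult, Cmod_R, Rabs_pos_eq by lra.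
  apply Rmult_le_compat_l; [lra|].
  assert (Real : Im c = 0%R -> Cmod c = Rabs (Re c)).
  { intros Hi. rewrite <- Cmod_R. f_equal. destruct c as [x y]. simpl in Hi. now subst y. }
  assert (Sq : (- (1)) * (- (1)) = RtoC 1) by ring.
  destruct (Nat.Even_or_Odd n) as [Ev|Od].
  - destruct (Heven Ev) as [Hi Hr]. destruct Ev as [m ->].
    rewrite Cpow_mult_r. change ((- (1)) ^ 2) with ((- (1)) * ((- (1)) * 1)).
    rewrite Cmult_1_r, Sq, Cpow_1_l, Cmult_1_l, (Real Hi), Rabs_pos_eq; lra.
  - destruct (Hodd Od) as [Hi Hr]. destruct Od as [m ->].
    rewrite Cpow_add_r, Cpow_mult_r, Cpow_1_r. change ((- (1)) ^ 2) with ((- (1)) * ((- (1)) * 1)).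
    rewrite Cmult_1_r, Sq, Cpow_1_l, Cmult_1_l, (Real Hi), Rabs_left1 by lra.
    replace (- (1) * c) with (- c) by ring. rewrite re_opp. lra.
Qed.

(** For a convergent Taylor series this is the triangle inequality: the moduli of
    the coefficients are [(-1)^n] times the coefficients. *)
Lemma negative_axis_majorant (f : C -> C) (w : C) :
  (forall z, in_disk z -> analytic_at f z) -> odd_nonpos_even_nonneg f ->
  in_disk w -> (Cmod (f w) <= Re (f (- Cmod w)%C))%R.
Proof.
  intros Hf Hs Hw. unfold in_disk in Hw.
  assert (exists u, Cmod u = 1%R /\ w = Cmod w * u) as (u & Hu & Ew).
  { destruct (Ceq_dec w 0) as [->|Hne].
    - exists 1. rewrite Cmod_1, Cmod_0. split; [reflexivity | ring].
    - assert (Hp : (0 < Cmod w)%R) by now apply Cmod_gt_0.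
      assert (Hn : RtoC (Cmod w) <> 0) by (intros E; apply RtoC_inj in E; lra).
      exists (w / Cmod w). split; [|field; exact Hn].
      rewrite Cmod_div, Cmod_R, Rabs_pos_eq by (exact Hn || lra). field. lra. }
  assert (M := derivative_majorant f u (- (1)) Hf Hu Cmod_m1
    (fun n => alternating_derivatives f n Hs) (Cmod w) (conj (Cmod_ge_0 w) Hw) 0%nat).
  rewrite <- Ew in M. simpl C_derive_n in M.
  replace ((- (1)) ^ 0 * f (Cmod w * - (1))) with (f (- Cmod w)) in M; [exact M|].
  replace (Cmod w * - (1)) with (- Cmod w) by ring. simpl. ring.
Qed.

(** * The pre-Schwarzian derivative *)

(** Two normed-module structures on [C], with different but equivalent uniform
    structures, occur in the statements of derivative lemmas. *)
Lemma is_derive_C_iff (f : C -> C) (z l : C) :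
  @is_derive C_AbsRing C_NormedModule f z l <->
  @is_derive C_AbsRing (AbsRing_NormedModule C_AbsRing) f z l.
Proof. split; intros [_ H]; (split; [apply is_linear_scal_l | exact H]). Qed.

Lemma is_derive_C_mult (f g : C -> C) (z df dg : C) :
  @is_derive C_AbsRing C_NormedModule f z df -> @is_derive C_AbsRing C_NormedModule g z dg ->
  @is_derive C_AbsRing C_NormedModule (fun y => f y * g y) z (df * g z + f z * dg).
Proof.
  intros Hf%is_derive_C_iff Hg%is_derive_C_iff. apply is_derive_C_iff.
  apply (is_derive_mult f g z df dg Hf Hg). intros n m. apply Cmult_comm.
Qed.

Lemma is_derive_C_comp (f g : C -> C) (z df dg : C) :
  @is_derive C_AbsRing C_NormedModule f (g z) df -> @is_derive C_AbsRing C_NormedModule g z dg ->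
  @is_derive C_AbsRing C_NormedModule (fun y => f (g y)) z (dg * df).
Proof.
  intros Hf Hg%is_derive_C_iff. apply (is_derive_comp (V := C_NormedModule) f g z df dg Hf Hg).
Qed.

Lemma is_derive_C_affine (a b z : C) :
  @is_derive C_AbsRing C_NormedModule (fun y => a + b * y) z b.
Proof.
  apply (is_derive_of_quadratic _ _ _ 0 1); [lra|]. intros h _.
  replace (a + b * (z + h) - (a + b * z) - b * h) with (RtoC 0) by ring.
  rewrite Cmod_0. lra.
Qed.

Lemma C_derive_reflect (phi : C -> C) (z : C) :
  analytic_at phi (- z) -> C_derive (fun y => phi (- y)) z = - C_derive phi (- z).
Proof.
  intros H. apply is_C_derive_unique.
  replace (- C_derive phi (- z)) with (- (1) * C_derive phi (- z)) by ring.
  apply (is_derive_C_comp phi (fun y => - y)); [now apply analytic_at_is_derive|].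
  apply (is_derive_ext (V := C_NormedModule) (fun y : C => 0 + - (1) * y)).
  - intros y. change (@eq C (0 + - (1) * y) (- y)). ring.
  - apply is_derive_C_affine.
Qed.

Lemma C_derive_ext_disk (f g : C -> C) (z l : C) :
  in_disk z -> (forall y, in_disk y -> f y = g y) ->
  @is_derive C_AbsRing C_NormedModule f z l -> @is_derive C_AbsRing C_NormedModule g z l.
Proof.
  intros Hz E. apply is_derive_ext_loc.
  assert (Hd : (0 < 1 - Cmod z)%R) by (unfold in_disk in Hz; lra).
  exists (mkposreal _ Hd). intros y Hy. apply E.
  assert (H := Cmod_near y z (1 - Cmod z)%R Hy). unfold in_disk. lra.
Qed.

(** Differentiating [z f'(z) = f(z) phi(w(z))] expresses [f''/f'] through [w]. *)
Lemma pre_schwarzian_formula (phi f w : C -> C) :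
  analytic_on_disk phi -> (forall z, in_disk z -> phi z <> 0) ->
  analytic_on_disk f -> f 0 = 0 -> (forall z, in_disk z -> z <> 0 -> f z <> 0) ->
  analytic_on_disk w -> (forall z, in_disk z -> in_disk (w z)) ->
  (forall z, in_disk z -> zf'_over_f f z = phi (w z)) ->
  forall z, in_disk z -> z <> 0 ->
  pre_schwarzian f z = (phi (w z) - 1) / z + C_derive w z * (C_derive phi (w z) / phi (w z)).
Proof.
  intros Hphi Hphi0 Hf Hf0 Hfnz Hw Hmap Hsub z Hz Hz0.
  assert (E : forall y, in_disk y -> y * C_derive f y = f y * phi (w y)).
  { intros y Hy. destruct (Ceq_dec y 0) as [->|Hne]; [rewrite Hf0; ring|].
    rewrite <- Hsub by exact Hy. unfold zf'_over_f. destruct (Ceq_dec y 0) as [|_]; [easy|].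
    field. now apply Hfnz. }
  assert (Af := analytic_on_disk_at f z Hf Hz). assert (Aw := analytic_on_disk_at w z Hw Hz).
  assert (Ap := analytic_on_disk_at phi (w z) Hphi (Hmap z Hz)).
  assert (D1 : @is_derive C_AbsRing C_NormedModule (fun y => y * C_derive f y) z
     (1 * C_derive f z + z * C_derive (C_derive f) z)).
  { apply (is_derive_C_mult (fun y => y)).
    - apply (is_derive_ext (V := C_NormedModule) (fun y : C => 0 + 1 * y)).
      + intros y. change (@eq C (0 + 1 * y) y). ring.
      + apply is_derive_C_affine.
    - now apply analytic_at_is_derive, analytic_at_derive. }
  assert (D2 : @is_derive C_AbsRing C_NormedModule (fun y => f y * phi (w y)) z
     (C_derive f z * phi (w z) + f z * (C_derive w z * C_derive phi (w z)))).
  { apply (is_derive_C_mult f (fun y => phi (w y))); [now apply analytic_at_is_derive|].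
    apply (is_derive_C_comp phi w); now apply analytic_at_is_derive. }
  apply (C_derive_ext_disk _ _ _ _ Hz E), is_C_derive_unique in D1.
  assert (D12 := eq_trans (eq_sym (is_C_derive_unique _ _ _ D2)) D1). clear D1 D2.
  assert (Hpz := Hphi0 _ (Hmap z Hz)). assert (Hfz := Hfnz z Hz Hz0).
  assert (Ez := E z Hz).
  assert (Hd : C_derive f z <> 0).
  { intros Hd. rewrite Hd, Cmult_0_r in Ez. symmetry in Ez. revert Ez.
    now apply Cmult_neq_0. }
  assert (Ef : f z = z * C_derive f z / phi (w z)) by (rewrite Ez; field; exact Hpz).
  assert (E2 : C_derive (C_derive f) z =
     (C_derive f z * phi (w z) + f z * (C_derive w z * C_derive phi (w z)) - C_derive f z) / z).
  { rewrite D12. field. exact Hz0. }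
  unfold pre_schwarzian. rewrite E2, Ef. field. auto.
Qed.

(** Let [s] tend to [0]. This covers the points where the estimate degenerates:
    the origin, and the zeros of the subordinating function. *)
Lemma bound_at_center (h : C -> C) (L : R) :
  analytic_at h 0 ->
  (forall s : R, 0 < s < 1 -> (1 - s ^ 2) * Cmod (h s) <= L)%R ->
  (Cmod (h 0) <= L)%R.
Proof.
  intros Hh HL. apply Rnot_lt_le. intros Hlt.
  set (q := ((Cmod (h 0) + L) / 2)%R).
  assert (HL0 : (0 <= L)%R).
  { eapply Rle_trans; [|apply (HL (1 / 2)%R); lra].
    apply Rmult_le_pos; [lra | apply Cmod_ge_0]. }
  destruct (analytic_at_continuous h 0 (q - L)%R Hh) as (d & Hd & Hcont); [unfold q; lra|].
  set (e := Rmin (d / 2) (Rmin (1 / 2) ((q - L) / (q + 1)))).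
  assert (He : (0 < e)%R).
  { repeat apply Rmin_pos; try lra. apply Rdiv_lt_0_compat; unfold q; lra. }
  assert (He1 : (e <= d / 2)%R) by apply Rmin_l.
  assert (He2 : (e <= 1 / 2)%R) by (eapply Rle_trans; [apply Rmin_r | apply Rmin_l]).
  assert (He3 : (e * (q + 1) <= q - L)%R).
  { assert (He3 : (e <= (q - L) / (q + 1))%R) by (eapply Rle_trans; [apply Rmin_r | apply Rmin_r]).
    apply Rle_div_r in He3; [exact He3 | unfold q; lra]. }
  clearbody e.
  assert (Hc : (Cmod (h e - h 0) < q - L)%R).
  { apply Hcont. replace (e - 0) with (RtoC e) by ring. rewrite Cmod_R, Rabs_pos_eq; lra. }
  assert (Hq : (q < Cmod (h e))%R).
  { assert (T : (Cmod (h 0) <= Cmod (h e) + Cmod (h e - h 0))%R).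
    { replace (h 0) with (h e + - (h e - h 0)) at 1 by ring.
      apply Rle_trans with (1 := Cmod_triangle _ _). rewrite Cmod_opp. lra. }
    unfold q in *. lra. }
  specialize (HL e ltac:(lra)).
  assert (He4 : (e ^ 2 <= e * (1 / 2))%R).
  { simpl. rewrite Rmult_1_r. apply Rmult_le_compat_l; lra. }
  assert (Hq0 : (L < q)%R) by (unfold q; lra).
  assert (H1 : ((1 - e ^ 2) * q <= (1 - e ^ 2) * Cmod (h e))%R) by (apply Rmult_le_compat_l; lra).
  assert (H2 : (e ^ 2 * q <= e * q)%R) by (apply Rmult_le_compat_r; lra).
  lra.
Qed.

(* In the bound, [- s phim'(s) / phim(s) - phim(s) + 1] is a real number under
   the hypotheses; [Re] only converts it from [C] to [R]. *)
Theorem theorem2p4 :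
  forall phi : C -> C,
  class_M phi ->
  odd_nonpos_even_nonneg (fun z : C => C_derive phi z / phi z) ->
  odd_nonpos_even_nonneg (fun z : C => 1 - phi z) ->
  let phim := fun z : C => phi (- z) in
  forall f : C -> C,
  ma_minda phi f ->
  Rbar_le (pre_schwarzian_norm f)
    (Lub_Rbar (fun x : R => exists s : R, (0 < s < 1)%R /\
       x = ((1 - s ^ 2) / s *
            Re (- (s * C_derive phim s / phim s) - phim s + 1))%R)).
Proof.
  intros phi (Hphi & _ & Hre & Hphi0 & _) HP HQ phim f ((Hf & Hf0 & Hf1) & Hfnz & (w & Hw & Hmap & Hw0 & Hsub)).
  set (P := fun z : C => C_derive phi z / phi z) in *.
  set (Q := fun z : C => 1 - phi z) in *.
  assert (Hnz : forall z, in_disk z -> phi z <> 0).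
  { intros z Hz E. specialize (Hre z Hz). rewrite E in Hre. simpl in Hre. lra. }
  assert (AP : forall z, in_disk z -> analytic_at P z).
  { intros z Hz. assert (A := analytic_on_disk_at phi z Hphi Hz).
    apply analytic_at_div; [now apply analytic_at_derive | exact A | now apply Hnz]. }
  assert (AQ : forall z, in_disk z -> analytic_at Q z).
  { intros z Hz. assert (A := analytic_on_disk_at phi z Hphi Hz).
    apply (analytic_at_ext (fun z => (1 + 0 * z) - phi z) _ z 1 Rlt_0_1).
    - intros y _. unfold Q. ring.
    - apply analytic_at_minus; [apply analytic_at_affine | exact A]. }
  assert (D0 : in_disk 0) by (unfold in_disk; rewrite Cmod_0; lra).
  set (T := fun s : R => ((1 - s ^ 2) * Re (P (- s)%C) + (1 - s ^ 2) / s * Re (Q (- s)%C))%R).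
  assert (ET : forall s, (0 < s < 1)%R ->
    ((1 - s ^ 2) / s * Re (- (s * C_derive phim s / phim s) - phim s + 1))%R = T s).
  { intros s Hs. assert (Ds : in_disk (- s)).
    { unfold in_disk. rewrite Cmod_opp, Cmod_R, Rabs_pos_eq; lra. }
    unfold phim. rewrite C_derive_reflect by now apply analytic_on_disk_at.
    replace (- (s * - C_derive phi (- s) / phi (- s)) - phi (- s) + 1)
      with (s * P (- s) + Q (- s)) by (unfold P, Q; field; now apply Hnz).
    rewrite re_plus, re_scal_l. unfold T. field. lra. }
  set (X := fun x : R => exists s : R, (0 < s < 1)%R /\ _ = _).
  destruct (Lub_Rbar_correct X) as [Hub _].
  assert (HT : forall s, (0 < s < 1)%R -> Rbar_le (T s) (Lub_Rbar X)).
  { intros s Hs. apply Hub. exists s. split; [exact Hs|]. symmetry. now apply ET. }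
  apply (proj2 (Lub_Rbar_correct _)).
  (* An infinite supremum is trivially large or, being that of a nonempty set,
     impossible. *)
  destruct (Lub_Rbar X) as [L| |]; [|easy|exfalso; exact (HT (1 / 2)%R ltac:(lra))].
  clear Hub X ET. simpl in HT.
  assert (MP : forall z, in_disk z -> (Cmod (P z) <= Re (P (- Cmod z)%C))%R)
    by (intros z Hz; now apply negative_axis_majorant).
  assert (MQ : forall z, in_disk z -> (Cmod (Q z) <= Re (Q (- Cmod z)%C))%R)
    by (intros z Hz; now apply negative_axis_majorant).
  assert (HPs : forall s : R, (0 < s < 1)%R -> ((1 - s ^ 2) * Cmod (P s) <= L)%R).
  { intros s Hs. apply Rle_trans with (2 := HT s Hs). unfold T.
    assert (Ms : Cmod s = s) by (rewrite Cmod_R; apply Rabs_pos_eq; lra).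
    assert (Ds : in_disk s) by (unfold in_disk; lra).
    assert (K1 := MP s Ds). assert (K2 := MQ s Ds). rewrite Ms in K1, K2.
    assert (S2 : (0 <= 1 - s ^ 2)%R) by (simpl; nra).
    assert (0 <= (1 - s ^ 2) / s * Re (Q (- s)%C))%R.
    { apply Rmult_le_pos; [apply Rdiv_le_0_compat; lra|].
      apply Rle_trans with (2 := K2), Cmod_ge_0. }
    assert ((1 - s ^ 2) * Cmod (P s) <= (1 - s ^ 2) * Re (P (- s)%C))%R
      by now apply Rmult_le_compat_l.
    lra. }
  assert (HP0 : (Cmod (P 0) <= L)%R) by (apply bound_at_center; [now apply AP | exact HPs]).
  assert (Main : forall z, in_disk z -> z <> 0 ->
    ((1 - Cmod z ^ 2) * Cmod (pre_schwarzian f z) <= L)%R).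
  { intros z Hz Hz0.
    rewrite (pre_schwarzian_formula phi f w) by assumption.
    assert (SP := schwarz_pick w Hw Hmap z Hz).
    assert (SL := schwarz w Hw Hmap Hw0 z Hz).
    assert (Hrp : (0 < Cmod z)%R) by now apply Cmod_gt_0.
    set (r := Cmod z) in *. unfold in_disk in Hz. fold r in Hz.
    assert (Dw := Hmap z Hz). set (s := Cmod (w z)) in *.
    assert (Hs0 : (0 <= s)%R) by apply Cmod_ge_0.
    assert (Hr2 : (0 < 1 - r ^ 2)%R) by (simpl; nra).
    apply Rle_trans with ((1 - r ^ 2) / r * Cmod (Q (w z)) + (1 - s ^ 2) * Cmod (P (w z)))%R.
    { apply Rle_trans with ((1 - r ^ 2) * (Cmod ((phi (w z) - 1) / z) +
        Cmod (C_derive w z * P (w z))))%R.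
      { apply Rmult_le_compat_l; [lra | apply Cmod_triangle]. }
      rewrite Rmult_plus_distr_l. apply Rplus_le_compat.
      - rewrite Cmod_div by exact Hz0. fold r.
        replace (phi (w z) - 1) with (- Q (w z)) by (unfold Q; ring). rewrite Cmod_opp.
        apply Req_le. field. lra.
      - rewrite Cmod_mult. rewrite <- Rmult_assoc.
        apply Rmult_le_compat_r; [apply Cmod_ge_0|]. lra. }
    (* For [w z <> 0] the estimate is the member of the supremum at [s = |w z|];
       for [w z = 0] no member corresponds to it, and a limit is needed. *)
    destruct (Ceq_dec (w z) 0) as [Ew|Ew].
    - unfold s. rewrite Ew. unfold Q. rewrite Hphi0.
      replace (1 - 1) with (RtoC 0) by ring. rewrite Cmod_0. simpl. lra.
    - assert (Hsp : (0 < s)%R) by now apply Cmod_gt_0.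
      assert (Hs1 : (s < 1)%R) by exact Dw.
      apply Rle_trans with (2 := HT s (conj Hsp Hs1)). unfold T.
      assert (K1 := MP _ Dw). assert (K2 := MQ _ Dw). fold s in K1, K2.
      assert (S2 : (0 <= 1 - s ^ 2)%R) by (simpl; nra).
      rewrite Rplus_comm. apply Rplus_le_compat; [now apply Rmult_le_compat_l|].
      apply Rmult_le_compat; [apply Rdiv_le_0_compat; lra | apply Cmod_ge_0 | | exact K2].
      assert (S3 : (s ^ 2 <= r ^ 2)%R) by (apply pow_incr; lra).
      unfold Rdiv. apply Rmult_le_compat; [lra | apply Rlt_le, Rinv_0_lt_compat, Hrp | lra |].
      apply Rinv_le_contravar; [exact Hsp | exact SL]. }
  intros x (z & Hz & ->). simpl.
  (* The formula for [f''/f'] divides by [z]; continuity handles the origin. *)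
  destruct (Ceq_dec z 0) as [->|Hz0]; [|now apply Main].
  rewrite Cmod_0.
  replace ((1 - 0 * (0 * 1)) * Cmod (pre_schwarzian f 0))%R with (Cmod (pre_schwarzian f 0)) by ring.
  assert (Af := analytic_on_disk_at f 0 Hf D0).
  apply bound_at_center.
  - apply analytic_at_div; [now apply analytic_at_derive, analytic_at_derive
      | now apply analytic_at_derive | rewrite Hf1; apply C1_nz].
  - intros s Hs.
    assert (Ms : Cmod s = s) by (rewrite Cmod_R; apply Rabs_pos_eq; lra).
    assert (M := Main s). rewrite Ms in M. apply M.
    + unfold in_disk; lra.
    + intros E. apply RtoC_inj in E. lra.
Qed.
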